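(* Let $L$ with the Dirichlet boundary condition on $D\subset\mathbb{R}^d$ be self-adjoint, with $L=\frac12\exp(-2Q)\nabla\cdot a\exp(2Q)\nabla$. Consider the following assertion (A): the Fourier series $$\sum_{n=0}^\infty\frac{F_n}{\lambda_n^D}\phi_n^D(x)$$ converges uniformly and absolutely on $D$. (i) If $d=1$, then (A) holds. (ii) Let $d=2$ and let $L=\frac12\exp(-2Q)\nabla\cdot a\exp(2Q)\nabla$ satisfy $Q=\frac12\log\sqrt{\det(a^{-1})}$ (up to an additive constant, which does not affect $L$). Then (A) holds. (iii) If $d\le3$ and the eigenfunctions $\{\phi_n^D\}_{n=0}^\infty$ are uniformly bounded, then (A) holds.
   Context: Setting: $D\subset\mathbb{R}^d$ is a bounded domain and $L=\frac12\nabla\cdot a\nabla+b\cdot\nabla$ is a second-order elliptic operator on $D$, where $a=\{a_{ij}\}_{i,j=1}^d$ is symmetric positive definite with entries in $C^{2,\alpha}(\mathbb{R}^d)$ and $b=(b_1,\dots,b_d)$ has entries in $C^{1,\alpha}(\mathbb{R}^d)$, for some $\alpha\in(0,1]$. Either $D$ has a $C^{2,\alpha}$-boundary, or $D=D_1\times\cdots\times D_k$ and $L=\sum_{i=1}^k L_i$, where $L_i$ is an operator (of the same type) on $D_i$ and $D_i$ has a $C^{2,\alpha}$-boundary. Self-adjoint case: ''$L$ with the Dirichlet boundary condition is self-adjoint'' means that $b=a\nabla Q$ for some function $Q$, so that $L=\frac12\exp(-2Q)\nabla\cdot a\exp(2Q)\nabla$; $Q$ is normalized by an additive constant so that $\int_D\exp(2Q)\,dx=1$,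 and $\mu_{\mathrm{rev}}$ denotes the probability measure $\exp(2Q)\,dx$ on $D$. $L$ with the Dirichlet boundary condition is then self-adjoint on $L^2(D,\mu_{\mathrm{rev}})$. Its eigenvalues are real and negative and are denoted $\{\lambda_n^D\}_{n=0}^\infty$, labeled in nonincreasing order and repeated according to multiplicity; $\{\phi_n^D\}_{n=0}^\infty$ is a corresponding orthonormal basis of $L^2(D,\mu_{\mathrm{rev}})$ of real eigenfunctions, with $\int_D(\phi_n^D)^2\,d\mu_{\mathrm{rev}}=1$ and $\phi_0^D>0$. Set $F_n\equiv\int_D\phi_n^D\,d\mu_{\mathrm{rev}}$. *)

(* Defs.v *)
From HB Require Import structures.
From mathcomp Require Import all_boot all_order all_algebra.
From mathcomp Require Import all_classical all_reals all_analysis.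

Set Implicit Arguments.
Unset Strict Implicit.
Unset Printing Implicit Defensive.

Import Order.TTheory GRing.Theory Num.Theory.
Import numFieldNormedType.Exports.

Local Open Scope classical_set_scope.
Local Open Scope ring_scope.

(** * Lebesgue measure on [R^n] *)

Section rV_measurable.
Context {R : realType} (n : nat).

(* The sigma-algebra generated by the coordinates, i.e. the Borel one. *)
Let coord (i : 'I_n) (x : 'rV[R]_n) : measurableTypeR R := x 0 i.

Let rV_set0 : g_sigma_preimage coord set0.
Proof. exact: sigma_algebra0. Qed.

Let rV_setC A : g_sigma_preimage coord A -> g_sigma_preimage coord (~` A).
Proof. exact: sigma_algebraC. Qed.

Let rV_bigcup (F : (set 'rV[R]_n)^nat) :
  (forall i, g_sigma_preimage coord (F i)) ->
  g_sigma_preimage coord (\bigcup_i F i).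
Proof. exact: sigma_algebra_bigcup. Qed.

HB.instance Definition _ := @isMeasurable.Build default_measure_display
  'rV[R]_n (g_sigma_preimage coord) rV_set0 rV_setC rV_bigcup.

End rV_measurable.

Lemma measurable_rV_coord (R : realType) n (i : 'I_n) :
  measurable_fun [set: 'rV[R]_n] (fun x => x 0 i : measurableTypeR R).
Proof.
move=> _ Y mY; rewrite setTI; apply: sub_sigma_algebra => /=.
rewrite -bigcup_seq/=; exists i => /=; first by rewrite mem_index_enum.
by exists Y => //; rewrite setTI.
Qed.

Lemma measurable_fun_rV d (T : measurableType d) (R : realType) n
    (f : T -> 'rV[R]_n) :
  (forall i, measurable_fun [set: T] (fun t => f t 0 i : measurableTypeR R)) ->
  measurable_fun [set: T] f.
Proof.
move=> mf; pose c i (x : 'rV[R]_n) : measurableTypeR R := x 0 i.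
suff S : g_sigma_preimage (fun i => c i \o f) `<=` measurable.
  move=> _ A mA; rewrite setTI; apply: S.
  by rewrite g_sigma_preimage_comp; exists A => //; rewrite setTI.
apply: smallest_sub; first exact: sigma_algebra_measurable.
elim/big_ind : _ => //.
- by move=> A B sA sB C [/sA|/sB].
- by move=> i _ A [B mB <-]; exact: mf.
Qed.

Definition rV_cons (R : realType) n (z : measurableTypeR R * 'rV[R]_n) :
  'rV[R]_n.+1 := row_mx (z.1 : R)%:M z.2.

Definition rV_uncons (R : realType) n (x : 'rV[R]_n.+1) :
  measurableTypeR R * 'rV[R]_n :=
  (x 0 0, rsubmx (x : 'rV[R]_(1 + n))).

Lemma rV_consK (R : realType) n : cancel (@rV_cons R n) (@rV_uncons R n).
Proof.
move=> [t y]; rewrite /rV_uncons /rV_cons /= row_mxKr; congr (_, _).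
have -> : 0 = lshift n 0 :> 'I_(1 + n) by exact/val_inj.
by rewrite (@row_mxEl _ _ 1 n) mxE.
Qed.

Lemma measurable_rV_cons (R : realType) n :
  measurable_fun [set: measurableTypeR R * 'rV[R]_n] (@rV_cons R n).
Proof.
apply: measurable_fun_rV => i; rewrite /rV_cons.
have [j ij|j ij] := @split_ordP 1 n i.
- rewrite [X in measurable_fun _ X](_ : _ = fst); first exact: measurable_fst.
  by apply/funext => z; rewrite ij (@row_mxEl _ _ 1 n) mxE ord1.
- rewrite [X in measurable_fun _ X](_ : _ =
      (fun y : 'rV[R]_n => y 0 j : measurableTypeR R) \o snd).
    exact: (measurableT_comp (measurable_rV_coord j) measurable_snd).
  by apply/funext => z; rewrite ij (@row_mxEr _ _ 1 n).
Qed.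

Lemma measurable_rV_uncons (R : realType) n :
  measurable_fun [set: 'rV[R]_n.+1] (@rV_uncons R n).
Proof.
apply/measurable_fun_pairP; split; first exact: measurable_rV_coord.
apply: measurable_fun_rV => i /=.
under eq_fun do rewrite mxE.
exact: measurable_rV_coord.
Qed.

Section lebesgue_rV_step.
Context {R : realType} (n : nat).
Variable mu : {sigma_finite_measure set 'rV[R]_n -> \bar R}.

Definition lebesgue_rV_step : set 'rV[R]_n.+1 -> \bar R :=
  pushforward (@lebesgue_measure R \x mu)%E (@rV_cons R n).

Let step0 : lebesgue_rV_step set0 = 0%E.
Proof. by rewrite /lebesgue_rV_step /pushforward preimage_set0 measure0. Qed.

Let step_ge0 A : (0 <= lebesgue_rV_step A)%E.
Proof. by rewrite /lebesgue_rV_step /pushforward measure_ge0. Qed.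

Let step_sigma_additive : semi_sigma_additive lebesgue_rV_step.
Proof.
have mc := @measurable_rV_cons R n.
move=> F mF tF mUF; rewrite /lebesgue_rV_step /pushforward preimage_bigcup.
apply: measure_semi_sigma_additive.
- by move=> i; rewrite -[X in measurable X]setTI; exact: mc.
- apply/trivIsetP => /= i j _ _ ij; rewrite -preimage_setI.
  by move/trivIsetP : tF => /(_ _ _ _ _ ij) ->//; rewrite preimage_set0.
- by rewrite -preimage_bigcup -[X in measurable X]setTI; exact: mc.
Qed.

HB.instance Definition _ := isMeasure.Build _ _ _ lebesgue_rV_step
  step0 step_ge0 step_sigma_additive.

Let step_sigma_finite : sigma_finite setT lebesgue_rV_step.
Proof.
have /sigma_finiteP[F [FT Fnd Foo]] := sigma_finiteT (@lebesgue_measure R).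
have /sigma_finiteP[G [GT Gnd Goo]] := sigma_finiteT mu.
exists (fun i => @rV_uncons R n @^-1` (F i `*` G i)).
  rewrite -preimage_bigcup -[LHS](preimage_setT (@rV_uncons R n)).
  congr (_ @^-1` _); apply/seteqP; split=> // -[x y] _.
  have /= [k _ Fx] : (\bigcup_i F i) x by rewrite -FT.
  have /= [l _ Gy] : (\bigcup_i G i) y by rewrite -GT.
  exists (maxn k l) => //; split => /=.
    by move: x Fx; exact/subsetPset/Fnd/leq_maxl.
  by move: y Gy; exact/subsetPset/Gnd/leq_maxr.
move=> i; have [mF Fi] := Foo i; have [mG Gi] := Goo i; split.
  rewrite -[X in measurable X]setTI; apply: measurable_rV_uncons => //.
  exact: measurableX.
rewrite /lebesgue_rV_step /pushforward.
rewrite (_ : _ @^-1` _ = F i `*` G i); last first.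
  by apply/funext => z; rewrite /preimage /mkset rV_consK.
by rewrite product_measure1E// lte_mul_pinfty// ge0_fin_numE.
Qed.

HB.instance Definition _ := Measure_isSigmaFinite.Build _ _ _ lebesgue_rV_step
  step_sigma_finite.

End lebesgue_rV_step.

Fixpoint lebesgue_rV (R : realType) n :
    {sigma_finite_measure set 'rV[R]_n -> \bar R} :=
  match n with
  | 0 => \d_ (0 : 'rV[R]_0)
  | m.+1 => lebesgue_rV_step (lebesgue_rV R m)
  end.

(** * Function spaces and domains *)

Definition partial (R : realType) n (i : 'I_n) (f : 'rV[R]_n -> R) :
  'rV[R]_n -> R := fun x => 'D_(delta_mx 0 i) f x.

Fixpoint is_Ck (R : realType) n (k : nat) (U : set 'rV[R]_n)
    (f : 'rV[R]_n -> R) : Prop :=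
  (forall x, U x -> {for x, continuous f}) /\
  match k with
  | 0 => True
  | k'.+1 => forall i : 'I_n,
      (forall x, U x -> derivable f x (delta_mx 0 i)) /\
      is_Ck k' U (partial i f)
  end.

(* [C^{k,alpha}(U)] for an open set [U]: the derivatives of order [k] are
   Hoelder continuous on the compact subsets of [U]. *)
Definition is_Ckalpha (R : realType) n (k : nat) (alpha : R)
    (U : set 'rV[R]_n) (f : 'rV[R]_n -> R) : Prop :=
  is_Ck k U f /\
  forall (s : k.-tuple 'I_n) (K : set 'rV[R]_n), compact K -> K `<=` U ->
    exists C : R, forall x y, K x -> K y ->
      `|foldr (@partial R n) f s x - foldr (@partial R n) f s y|
        <= C * `|x - y| `^ alpha.

Definition bounded_domain (R : realType) n (D : set 'rV[R]_n) : Prop :=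
  [/\ open D, connected D, D !=set0 & bounded_set D].

(* Every boundary point has a neighbourhood [B] with a [C^{k,alpha}]
   diffeomorphism [psi] (with inverse [chi]) onto an open set, mapping [B `&` D]
   into an open half-space and the part of the boundary in [B] into the bounding
   hyperplane.  The boundary of the open set [D] is [closure D `\` D]. *)
Definition Ckalpha_boundary (R : realType) n (k : nat) (alpha : R)
    (D : set 'rV[R]_n) : Prop :=
  forall x0, (closure D `\` D) x0 ->
  exists (B : set 'rV[R]_n) (psi chi : 'rV[R]_n -> 'rV[R]_n) (j : 'I_n),
    [/\ open B /\ B x0,
        open (psi @` B) /\ (forall x, B x -> chi (psi x) = x),
        (forall i, is_Ckalpha k alpha B (fun x => psi x 0 i)) /\
        (forall i, is_Ckalpha k alpha (psi @` B) (fun y => chi y 0 i)),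
        forall x, B x -> D x -> 0 < psi x 0 j &
        forall x, B x -> (closure D `\` D) x -> psi x 0 j = 0].

(** * The operator *)

(* [L u = 1/2 div (a grad u) + b . grad u] *)
Definition elliptic_op (R : realType) n (a : 'rV[R]_n -> 'M[R]_n)
    (b : 'rV[R]_n -> 'rV[R]_n) (u : 'rV[R]_n -> R) (x : 'rV[R]_n) : R :=
  2^-1 * (\sum_i partial i (fun y => \sum_j a y i j * partial j u y) x)
  + \sum_i b x 0 i * partial i u x.

Definition elliptic_coefficients (R : realType) n (alpha : R)
    (a : 'rV[R]_n -> 'M[R]_n) (b : 'rV[R]_n -> 'rV[R]_n) : Prop :=
  [/\ forall x, (a x)^T = a x,
      forall x (v : 'rV[R]_n), v != 0 -> 0 < (v *m a x *m v^T) 0 0,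
      forall i j, is_Ckalpha 2 alpha setT (fun x => a x i j) &
      forall i, is_Ckalpha 1 alpha setT (fun x => b x 0 i)].

(* [D = D_1 x ... x D_k] and [L = L_1 + ... + L_k], with [L_i] acting on the
   [i]-th block of variables: [a] is block diagonal, and the [i]-th blocks of
   [a] and [b] are the coefficients of [L_i], functions of the [i]-th block of
   variables only.  The equality [e] is used to cut ['rV_d] into blocks. *)
Definition product_setting (R : realType) d (alpha : R) (D : set 'rV[R]_d)
    (a : 'rV[R]_d -> 'M[R]_d) (b : 'rV[R]_d -> 'rV[R]_d) : Prop :=
  exists (k : nat) (p : 'I_k -> nat) (e : (\sum_i p i)%N = d)
    (D_ : forall i, set 'rV[R]_(p i))
    (a_ : forall i, 'rV[R]_(p i) -> 'M[R]_(p i))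
    (b_ : forall i, 'rV[R]_(p i) -> 'rV[R]_(p i)),
  let block (x : 'rV[R]_d) i : 'rV[R]_(p i) :=
    submxrow (castmx (erefl 1, esym e) x) i in
  [/\ (0 < k)%N,
      forall i, [/\ (0 < p i)%N, bounded_domain (D_ i),
        Ckalpha_boundary 2 alpha (D_ i) &
        elliptic_coefficients alpha (a_ i) (b_ i)],
      D = [set x | forall i, D_ i (block x i)],
      forall x, D x -> a x = castmx (e, e) (\mxdiag_i a_ i (block x i)) &
      forall x, D x -> b x = castmx (erefl 1, e) (\mxrow_i b_ i (block x i))].

Definition standing_assumptions (R : realType) d (alpha : R)
    (D : set 'rV[R]_d) (a : 'rV[R]_d -> 'M[R]_d) (b : 'rV[R]_d -> 'rV[R]_d) :
    Prop :=
  [/\ (0 < d)%N, 0 < alpha <= 1, bounded_domain D,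
      elliptic_coefficients alpha a b &
      Ckalpha_boundary 2 alpha D \/ product_setting alpha D a b].

(** * The self-adjoint Dirichlet problem *)

(* The extended-valued integral of a nonnegative function against
   [mu_rev = exp(2Q) dx] on [D]. *)
Definition eint_rev (R : realType) d (D : set 'rV[R]_d) (Q f : 'rV[R]_d -> R) :
    \bar R :=
  (\int[lebesgue_rV R d]_(x in D) (f x * expR (2 * Q x))%R%:E)%E.

Definition int_rev (R : realType) d (D : set 'rV[R]_d) (Q f : 'rV[R]_d -> R) :
    R :=
  fine (eint_rev D Q f).

(* [b = a grad Q] on [D], so that [L = 1/2 exp(-2Q) div (a exp(2Q) grad)]; [Q] is
   normalized so that [mu_rev] is a probability measure. *)
Definition self_adjoint (R : realType) d (D : set 'rV[R]_d)
    (a : 'rV[R]_d -> 'M[R]_d) (b : 'rV[R]_d -> 'rV[R]_d)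
    (Q : 'rV[R]_d -> R) : Prop :=
  [/\ is_Ck 1 D Q,
      forall x i, D x -> b x 0 i = \sum_j a x i j * partial j Q x &
      eint_rev D Q (fun=> 1) = 1%E].

Definition dirichlet_eigenfunction (R : realType) d (D : set 'rV[R]_d)
    (a : 'rV[R]_d -> 'M[R]_d) (b : 'rV[R]_d -> 'rV[R]_d)
    (lambda : R) (phi : 'rV[R]_d -> R) : Prop :=
  [/\ is_Ck 2 D phi, {within closure D, continuous phi},
      forall x, (closure D `\` D) x -> phi x = 0 &
      forall x, D x -> elliptic_op a b phi x = lambda * phi x].

Definition L2_rev (R : realType) d (D : set 'rV[R]_d) (Q f : 'rV[R]_d -> R) :
    Prop :=
  measurable_fun D f /\ (eint_rev D Q (fun x => f x ^+ 2)%R < +oo)%E.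

Definition orthonormal_basis (R : realType) d (D : set 'rV[R]_d)
    (Q : 'rV[R]_d -> R) (phi : nat -> 'rV[R]_d -> R) : Prop :=
  [/\ forall n, L2_rev D Q (phi n),
      forall m n, int_rev D Q (fun x => phi m x * phi n x) = (m == n)%:R &
      forall f, L2_rev D Q f ->
        eint_rev D Q (fun x => (f x -
          \sum_(n < N) int_rev D Q (fun y => f y * phi n y) * phi n x) ^+ 2)
          @[N --> \oo] --> 0%E].

(* As [phi] is a basis of eigenfunctions, [lambda] lists every eigenvalue as
   often as its multiplicity. *)
Definition dirichlet_eigenbasis (R : realType) d (D : set 'rV[R]_d)
    (a : 'rV[R]_d -> 'M[R]_d) (b : 'rV[R]_d -> 'rV[R]_d) (Q : 'rV[R]_d -> R)
    (lambda : nat -> R) (phi : nat -> 'rV[R]_d -> R) : Prop :=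
  [/\ forall m n, (m <= n)%N -> lambda n <= lambda m,
      forall n, dirichlet_eigenfunction D a b (lambda n) (phi n),
      orthonormal_basis D Q phi &
      forall x, D x -> 0 < phi 0%N x].

Definition fourier_term (R : realType) d (D : set 'rV[R]_d) (Q : 'rV[R]_d -> R)
    (lambda : nat -> R) (phi : nat -> 'rV[R]_d -> R) (n : nat)
    (x : 'rV[R]_d) : R :=
  int_rev D Q (phi n) / lambda n * phi n x.

Definition converges_uniformly_absolutely (R : realType) d (D : set 'rV[R]_d)
    (u : nat -> 'rV[R]_d -> R) : Prop :=
  (exists S : 'rV[R]_d -> R,
     {uniform D, (fun N x => \sum_(n < N) u n x) @ \oo --> S}) /\
  (forall x, D x -> cvgn (series (fun n => `|u n x|))).

(* Main.v *)
(** For [d <= 3] the Dirichlet resolvent maps [L^2(mu_rev)] to bounded functions: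
    if [L u = f] in [D] and [u = 0] on the boundary, then
    [sup |u|^2 <= C int f^2 d mu_rev].  For fixed [x], apply this to
    [u = sum_k phi_k(x) / lambda_k^2 phi_k], for which [u(x)] and
    [int (L u)^2 d mu_rev] are both equal to [sum_k (phi_k(x) / lambda_k)^2]: this
    sum is at most [C], uniformly in [x].  Cauchy-Schwarz and Bessel's inequality
    [sum_k F_k^2 <= 1] then bound the tails of the Fourier series uniformly.

    The resolvent bound is De Giorgi's iteration over levels [k_j] increasing from
    [U/4] to [U/2], where [U = sup u > 0].  Testing the equation with [(u - k)_+^2]
    and the Faber-Krahn inequality [int w^2 <= 4 n h^2 int |grad w|^2], valid when
    [{w <> 0}] has measure at most [h^n / 4], show that if [U^2] is large compared to
    [int f^2 d mu_rev], then [{u > k_j}] has measure at most [(h_0 16^-j)^n / 4] for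
    all [j], so that the nonempty open set [{u > U/2}] is null, which is absurd.

    To compare [mu_rev] with Lebesgue measure one needs [Q] to be bounded.  The
    gradient of [Q] is bounded because [b = a grad Q], and the boundary charts join
    nearby points of [D] by paths in [D] of controlled length. *)
Require Import Defs.
From mathcomp Require Import all_boot all_order all_algebra.
From mathcomp Require Import all_classical all_reals all_analysis.
From mathcomp Require Import measurable_realfun.
From mathcomp Require Import ring lra.
Set Implicit Arguments.
Unset Strict Implicit.
Unset Printing Implicit Defensive.
Import Order.TTheory GRing.Theory Num.Theory.
Import numFieldNormedType.Exports.
Local Open Scope classical_set_scope.
Local Open Scope ring_scope.

(** * Lebesgue measure on ['rV_n] *)

(** The solutions are [C^2] inside [D] but merely continuous on its closure: nothing controls their
    gradients at the boundary, so integrating by parts over [D] is not directly possible. For a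
    level [k > 0], however, [u < k] near the boundary, and the square of [(u - k)_+], unlike
    [(u - k)_+] itself, has no kink. Extended by 0 it is a [C^1] function on the whole space with
    bounded support. All integrations therefore take place on the whole space, where translation
    invariance of Lebesgue measure yields both the divergence theorem and the Faber-Krahn
    inequality, and classical derivatives suffice. The restriction on the dimension comes from the
    balance of two powers. With [w = (u - k)_+^2] supported on a set of measure about [h^n], the
    Faber-Krahn inequality contributes a factor [h^2] and the energy inequality, after optimizing
    its parameter, another [h^2]; hence [int w^2] is of order [h^4], and so is the measure of the
    next superlevel set. Iterating gains when [h^4] is smaller than [h^n] for small [h], that is,
    when [n < 4]. *)

Section rV_basics.
Context {R : realType} {n : nat}.
Implicit Types (x y z : 'rV[R]_n) (A D : set 'rV[R]_n).

Lemma rV_norm_leP x (e : R) : 0 <= e ->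
  reflect (forall i, `|x 0 i| <= e) (`|x| <= e).
Proof.
move=> e0; rewrite [`|x|]mx_normrE; apply: (iffP (bigmax_leP _ _ _ _)) => [[_ h] i|h].
  by have := h (0, i) isT.
by split=> // -[i j] _ /=; rewrite ord1.
Qed.

Lemma rV_norm_ltP x (e : R) : 0 < e ->
  reflect (forall i, `|x 0 i| < e) (`|x| < e).
Proof.
move=> e0; rewrite [`|x|]mx_normrE; apply: (iffP (bigmax_ltP _ _ _ _)) => [[_ h] i|h].
  by have := h (0, i) isT.
by split=> // -[i j] _ /=; rewrite ord1.
Qed.

Lemma rV_coord_norm x i : `|x 0 i| <= `|x|.
Proof. by move: i; apply/rV_norm_leP. Qed.

Lemma ball_rVP x (e : R) y : 0 < e ->
  ball x e y <-> forall i, `|x 0 i - y 0 i| < e.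
Proof.
move=> e0; rewrite -ball_normE /ball_ /=.
split=> [/rV_norm_ltP h i|h].
  by have := h e0 i; rewrite !mxE.
by apply/rV_norm_ltP => // i; rewrite !mxE.
Qed.

Lemma measurable_ball_rV x (e : R) : 0 < e -> measurable (ball x e).
Proof.
move=> e0.
have -> : ball x e = \bigcap_(i in [set: 'I_n])
    ((fun y : 'rV[R]_n => y 0 i : measurableTypeR R) @^-1` ball (x 0 i) e).
  apply/seteqP; split=> y.
    by move=> /(ball_rVP _ _ e0) h i _; rewrite /= -ball_normE /=; exact: h.
  by move=> h; apply/ball_rVP => // i; have := h i Logic.I; rewrite /= -ball_normE.
apply: fin_bigcap_measurable => // i _; rewrite -[X in measurable X]setTI.
by apply: measurable_rV_coord => //; apply: open_measurable; exact: ball_open.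
Qed.

(** There are countably many balls with rational centre and radius [1 / (k + 1)], and each is a
    finite intersection of preimages under coordinates because the norm is the sup norm. *)
Lemma open_measurable_rV A : open A -> measurable A.
Proof.
move=> oA; pose q (p : 'rV[rat]_n * nat) : 'rV[R]_n := map_mx ratr p.1.
pose B p := ball (q p) (p.2.+1%:R^-1 : R).
have B0 p : 0 < p.2.+1%:R^-1 :> R by rewrite invr_gt0.
have -> : A = \bigcup_(p in [set p | B p `<=` A]) B p.
  apply/seteqP; split=> [x Ax|x [p /= pA]]; last exact: pA.
  have [e /= e0 eA] : nbhs_ball x A by apply/nbhs_ballP; exact: open_nbhs_nbhs.
  have e20 : 0 < e / 2 by rewrite divr_gt0.
  have [k ke] : exists k, k.+1%:R^-1 < e / 2 :> R.
    have [k _ /(_ k (leqnn k)) /= h] := near_infty_natSinv_lt (PosNum e20).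
    by exists k.
  have /choice [f hf] (i : 'I_n) : exists r : rat, `|ratr r - x 0 i| < k.+1%:R^-1 :> R.
    have /rat_in_itvoo[r] : x 0 i - k.+1%:R^-1 < x 0 i + k.+1%:R^-1.
      by rewrite ltrBlDr -addrA ltrDl addr_gt0.
    by rewrite in_itv /= => hr; exists r; rewrite ltr_distl.
  have qx : B (\row_i f i, k) x by apply/ball_rVP => // i; rewrite !mxE.
  exists (\row_i f i, k) => //= y By; apply: eA.
  apply: (@ball_splitr _ _ (q (\row_i f i, k))).
    by apply: le_ball qx; exact: ltW.
  by apply: le_ball By; exact: ltW.
rewrite bigcup_mkcond; apply: countable_bigcupT_measurable => [|p].
  exact: countableP.
by case: ifPn => // _; exact: measurable_ball_rV.
Qed.

Lemma measurable_fun_rV_continuous D (f : 'rV[R]_n -> R) : open D ->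
  (forall x, D x -> {for x, continuous f}) ->
  measurable_fun D (f : _ -> measurableTypeR R).
Proof.
move=> oD cf; apply: (measurability _ (RGenOpens.measurableE R)).
move=> _ [_ [a [b ->]] <-]; apply: open_measurable_rV.
rewrite openE => x [Dx /= fx]; apply: filterI; first exact: open_nbhs_nbhs.
apply: cf => //; apply: open_nbhs_nbhs; split=> //; exact: interval_open.
Qed.

Lemma measurable_rVD z : measurable_fun [set: 'rV[R]_n] (fun x => x + z).
Proof.
apply: measurable_fun_rV => i; under eq_fun do rewrite mxE.
apply: measurable_funD => //; exact: measurable_rV_coord.
Qed.

End rV_basics.

(** The image of Lebesgue measure under a translation agrees with it on half-open intervals, hence
    equals it by uniqueness. *)
Lemma ge0_integral_lebesgue_shift (R : realType) (f : R -> \bar R) (c : R) :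
  measurable_fun [set: measurableTypeR R] f -> (forall t, 0 <= f t)%E ->
  (\int[@lebesgue_measure R]_t f (t + c)%R = \int[@lebesgue_measure R]_t f t)%E.
Proof.
move=> mf f0; pose s (t : measurableTypeR R) : measurableTypeR R := t + c.
have ms : measurable_fun [set: measurableTypeR R] s.
  by apply: measurable_funD => //; exact: measurable_id.
transitivity (\int[pushforward (@lebesgue_measure R) s]_t f t)%E.
  by rewrite ge0_integral_pushforward.
apply: eq_measure_integral => //= A mA _; apply/esym.
apply: lebesgue_measure_unique => // _ [[a b]] _ <-.
rewrite [RHS]/= /pushforward /=.
rewrite (_ : s @^-1` _ = `]a - c, b - c]%classic); last first.
  by apply/seteqP; split=> t; rewrite /s /= !in_itv /= ltrBlDr lerBrDr.
rewrite !lebesgue_measure_itv /= !lte_fin ltrD2r.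
by case: ifP => // _; rewrite -!EFinB; congr EFin; rewrite opprB addrA subrK.
Qed.

Section lebesgue_rV.
Context {R : realType}.
Implicit Types n : nat.

(** [lebesgue_rV R n.+1] is by construction the image of a product measure under [rV_cons], so this
    is Tonelli's theorem; it drives the inductions on the dimension. *)
Lemma ge0_integral_rVS n (f : 'rV[R]_n.+1 -> \bar R) :
  measurable_fun [set: 'rV[R]_n.+1] f -> (forall x, 0 <= f x)%E ->
  (\int[lebesgue_rV R n.+1]_x f x =
   \int[@lebesgue_measure R]_t \int[lebesgue_rV R n]_y f (rV_cons (t, y)))%E.
Proof.
move=> mf f0.
transitivity (\int[pushforward (@lebesgue_measure R \x lebesgue_rV R n)%E
    (@rV_cons R n)]_x f x)%E.
  by apply: eq_measure_integral => *; [exact: measurable_rV_cons|].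
rewrite ge0_integral_pushforward//; last exact: measurable_rV_cons.
rewrite preimage_setT fubini_tonelli1//; last by move=> z; exact: f0.
exact: measurableT_comp mf (@measurable_rV_cons R n).
Qed.

Lemma rV_consD n t (y : 'rV[R]_n) (z : 'rV[R]_n.+1) :
  rV_cons (t, y) + z = rV_cons (t + (rV_uncons z).1, y + (rV_uncons z).2).
Proof.
rewrite /rV_cons /rV_uncons /=; apply/rowP => i; rewrite mxE.
have [j ->|j ->] := @split_ordP 1 n i.
  by rewrite !(@row_mxEl _ _ 1 n) ord1 !mxE; congr (_ + z _ _); apply/val_inj.
by rewrite !(@row_mxEr _ _ 1 n) !mxE.
Qed.

Lemma ge0_integral_rV_shift n (z : 'rV[R]_n) (f : 'rV[R]_n -> \bar R) :
  measurable_fun [set: 'rV[R]_n] f -> (forall x, 0 <= f x)%E ->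
  (\int[lebesgue_rV R n]_x f (x + z)%R = \int[lebesgue_rV R n]_x f x)%E.
Proof.
elim: n z f => [|n IH] z f mf f0.
  by apply: eq_integral => x _; congr f; rewrite [LHS]thinmx0 [RHS]thinmx0.
have mfc : measurable_fun setT (fun p => f (rV_cons p)).
  exact: measurableT_comp mf (@measurable_rV_cons R n).
rewrite !ge0_integral_rVS//; last exact: measurableT_comp (measurable_rVD z).
pose g t := (\int[lebesgue_rV R n]_y f (rV_cons (t, y)))%E.
rewrite -(@ge0_integral_lebesgue_shift _ g (rV_uncons z).1).
- apply: eq_integral => t _; rewrite /g.
  rewrite -[RHS](IH (rV_uncons z).2).
  + by apply: eq_integral => y _; rewrite rV_consD.
  + exact: measurableT_comp mfc (measurable_pair1 _).
  + by [].
- exact: (@measurable_fun_fubini_tonelli_F _ _ _ _ _ (lebesgue_rV R n) _ mfc (fun p => f0 _)).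
- by move=> t; exact: integral_ge0.
Qed.

Lemma integral_rV_shift n (z : 'rV[R]_n) (f : 'rV[R]_n -> \bar R) :
  measurable_fun [set: 'rV[R]_n] f ->
  (\int[lebesgue_rV R n]_x f (x + z)%R = \int[lebesgue_rV R n]_x f x)%E.
Proof.
move=> mf; rewrite integralE [RHS]integralE.
rewrite -(ge0_integral_rV_shift z (measurable_funepos mf))//.
rewrite -(ge0_integral_rV_shift z (measurable_funeneg mf)) => [|x]; last exact: funeneg_ge0.
by congr (_ - _)%E; apply: eq_integral => x _; rewrite ?funeposE ?funenegE.
Qed.

(** One corner is at the origin: the points serve as translation vectors in the averaging argument
    of [faber_krahn]. *)
Definition cube n (h : R) : set 'rV[R]_n := [set x | forall i, 0 <= x 0 i <= h].

Lemma measurable_cube n h : measurable (@cube n h).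
Proof.
have -> : @cube n h = \bigcap_(i in [set: 'I_n])
    ((fun y : 'rV[R]_n => y 0 i : measurableTypeR R) @^-1` `[0, h]%classic).
  apply/seteqP; split=> y /= H i; first by move=> _; rewrite /= in_itv /=.
  by have := H i Logic.I; rewrite /= in_itv.
apply: fin_bigcap_measurable => // i _; rewrite -[X in measurable X]setTI.
by apply: measurable_rV_coord => //; exact: measurable_itv.
Qed.

Lemma measurable_EFin_indic d (T : measurableType d) (A : set T) :
  measurable A -> measurable_fun setT (fun x : T => (\1_A x : R)%:E).
Proof. by move=> mA; apply/measurable_EFinP; exact: measurable_indic. Qed.

Lemma lebesgue_rV_cube n (h : R) : 0 <= h ->
  lebesgue_rV R n (@cube n h) = (h ^+ n)%:E.
Proof.
move=> h0; elim: n => [|n IH].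
  rewrite expr0 /= diracE mem_set// => -[].
  by case.
transitivity (\int[lebesgue_rV R n.+1]_x (\1_(@cube n.+1 h) x)%:E)%E.
  have mc := @measurable_cube n.+1 h; rewrite integral_indic ?setIT//.
rewrite ge0_integral_rVS//; last by apply: measurable_EFin_indic; exact: measurable_cube.
have E t y : \1_(@cube n.+1 h) (rV_cons (t, y)) = \1_`[0, h] t * \1_(@cube n h) y :> R.
  rewrite !indicE -natrM mulnb; congr (_%:R); congr nat_of_bool.
  apply/idP/andP; rewrite !inE /= in_itv /=.
    move=> H; split; last first.
      by move=> i; have := H (rshift 1 i); rewrite /rV_cons (@row_mxEr _ _ 1 n).
    by have := H (lshift n (0 : 'I_1)); rewrite /rV_cons (@row_mxEl _ _ 1 n) mxE.
  move=> [th yh] i; rewrite /rV_cons /=.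
  by have [j ->|j ->] := @split_ordP 1 n i; rewrite ?(@row_mxEl _ _ 1 n) ?(@row_mxEr _ _ 1 n)// mxE ord1.
transitivity (\int[@lebesgue_measure R]_t (\1_`[0, h] t * h ^+ n)%:E)%E.
  apply: eq_integral => t _.
  under eq_integral do rewrite E EFinM.
  rewrite ge0_integralZl_EFin//; last first.
    by apply: measurable_EFin_indic; exact: measurable_cube.
  rewrite integral_indic ?setIT//; last exact: measurable_cube.
  by rewrite EFinM; congr (_ * _)%E; exact: IH.
under eq_integral do rewrite mulrC EFinM.
rewrite ge0_integralZl_EFin//; [|exact: measurable_EFin_indic|exact: exprn_ge0].
rewrite integral_indic// setIT.
have -> : lebesgue_measure_lebesgue_measure__canonical__measure_function_Measure R `[0, h]%classic = h%:E.
  rewrite -[LHS]/(lebesgue_measure `[0, h]%classic) lebesgue_measure_itv /= lte_fin.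
  case: ltP => [_|h0']; first by rewrite -EFinB subr0.
  by rewrite (@le_anti _ _ h 0) ?h0 ?h0'.
by rewrite -EFinM exprSr.
Qed.

Lemma lebesgue_rV_shift n (z : 'rV[R]_n) (A : set 'rV[R]_n) : measurable A ->
  lebesgue_rV R n ((fun x => x + z) @^-1` A) = lebesgue_rV R n A.
Proof.
move=> mA; have mzA : measurable ((fun x => x + z) @^-1` A).
  by rewrite -[X in measurable X]setTI; exact: measurable_rVD.
have E B : measurable B ->
    lebesgue_rV R n B = (\int[lebesgue_rV R n]_x (\1_B x)%:E)%E.
  by move=> mB; rewrite integral_indic ?setIT.
rewrite !E// -(integral_rV_shift z (f := fun x => (\1_A x)%:E)).
  by apply: eq_integral.
exact: measurable_EFin_indic.
Qed.

Lemma bounded_lebesgue_rV n (A : set 'rV[R]_n) (r : R) : measurable A ->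
  (forall x, A x -> `|x| <= r) -> (lebesgue_rV R n A < +oo)%E.
Proof.
move=> mA Ar; have [r0|r0] := ltP r 0.
  rewrite (_ : A = set0) ?measure0 ?ltry//; apply/seteqP; split=> // x /Ar.
  by move=> /le_lt_trans /(_ r0); rewrite ltNge normr_ge0.
pose z : 'rV[R]_n := const_mx r.
have m1 : measurable ((fun x => x + z) @^-1` @cube n (r + r)).
  rewrite -[X in measurable X]setTI.
  by apply: measurable_rVD => //; exact: measurable_cube.
have sub : A `<=` (fun x => x + z) @^-1` @cube n (r + r).
  move=> x /Ar /rV_norm_leP h i; rewrite !mxE.
  by have := h r0 i; rewrite ler_norml => /andP[h1 h2]; rewrite -lerBlDr sub0r h1 /= lerD2r.
apply: (@le_lt_trans _ _ (lebesgue_rV R n ((fun x => x + z) @^-1` @cube n (r + r)))).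
  by apply: le_measure; rewrite ?inE.
rewrite lebesgue_rV_shift; last exact: measurable_cube.
by rewrite lebesgue_rV_cube ?ltry// addr_ge0.
Qed.

Lemma lebesgue_rV_open_gt0 n (A : set 'rV[R]_n) : open A -> A !=set0 ->
  (0 < lebesgue_rV R n A)%E.
Proof.
move=> oA [x Ax].
have [e /= e0 eA] : nbhs_ball x A by apply/nbhs_ballP; exact: open_nbhs_nbhs.
pose h := e / 2; have h0 : 0 < h by rewrite divr_gt0.
have m1 : measurable ((fun y => y + - x) @^-1` @cube n h).
  rewrite -[X in measurable X]setTI.
  by apply: measurable_rVD => //; exact: measurable_cube.
have sub : (fun y => y + - x) @^-1` @cube n h `<=` A.
  move=> y /= H; apply/eA/ball_rVP => // i.
  have := H i; rewrite !mxE => /andP[h1 h2]; rewrite distrC ger0_norm//.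
  by apply: le_lt_trans h2 _; rewrite /h ltr_pdivrMr// ltr_pMr// ltr1n.
have mA := open_measurable_rV oA.
apply: (@lt_le_trans _ _ (lebesgue_rV R n ((fun y => y + - x) @^-1` @cube n h))); last first.
  by apply: le_measure; rewrite ?inE.
rewrite lebesgue_rV_shift; last exact: measurable_cube.
by rewrite lebesgue_rV_cube ?lte_fin ?exprn_gt0// ltW.
Qed.
End lebesgue_rV.

(** * Bounded measurable functions with bounded support *)

Section tame.
Context {R : realType} {n : nat}.
Implicit Types (f g : 'rV[R]_n -> R) (A : set 'rV[R]_n).

Local Notation mu := (lebesgue_rV R n).

(** A class that is stable under sums, products and translations and consists of integrable
    functions, so that integrability never has to be argued anew. The radius [r] may be negative, in
    which case [f] is zero. *)
Definition tame f := measurable_fun [set: 'rV[R]_n] f /\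
  exists M r : R, forall x, `|f x| <= M /\ (r < `|x| -> f x = 0).

Lemma closed_norm_le (r : R) : closed [set x : 'rV[R]_n | `|x| <= r].
Proof.
apply: (@preimage_closed _ _ (Num.norm : 'rV[R]_n -> R) [set y : R | y <= r]).
  by move=> x _; exact: norm_continuous.
exact: closed_le.
Qed.

Lemma compact_norm_le (r : R) : compact [set x : 'rV[R]_n | `|x| <= r].
Proof.
apply: bounded_closed_compact; last exact: closed_norm_le.
by exists r; split=> [|y ry x xr]; [exact: num_real|exact: le_trans xr (ltW ry)].
Qed.

Lemma measurable_norm_le (r : R) : measurable [set x : 'rV[R]_n | `|x| <= r].
Proof.
rewrite -[X in measurable X]setCK; apply: measurableC; apply: open_measurable_rV.
by rewrite openC; exact: closed_norm_le.
Qed.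

Lemma tame_integrable f : tame f -> mu.-integrable setT (EFin \o f).
Proof.
move=> [mf [M [r Mr]]].
have mB := measurable_norm_le r.
have -> : EFin \o f = EFin \o (f \_ [set x | `|x| <= r]).
  apply/funext => x /=; rewrite patchE; case: ifPn => //; rewrite notin_setE /=.
  by move/negP; rewrite -ltNge => /(Mr x).2 ->.
rewrite -restrict_EFin; apply/integrable_restrict => //; rewrite setTI.
apply: measurable_bounded_integrable => //.
- by apply: (@bounded_lebesgue_rV _ _ _ r).
- exact: measurable_funS mf.
- exists M; split; first exact: num_real.
  by move=> y My x _; apply: le_trans (Mr x).1 _; exact: ltW.
Qed.

Lemma tame_le f g : measurable_fun [set: 'rV[R]_n] f -> tame g ->
  (forall x, `|f x| <= `|g x|) -> tame f.
Proof.
move=> mf [mg [M [r Mr]]] fg; split=> //; exists M, r => x; split.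
  exact: le_trans (fg x) (Mr x).1.
by move=> /(Mr x).2 gx; apply/eqP; rewrite -normr_le0; have := fg x; rewrite gx normr0.
Qed.

Lemma tame0 : tame (fun=> 0).
Proof. by split; [exact: measurable_cst|exists 0, 0 => x; rewrite normr0]. Qed.

Lemma tameD f g : tame f -> tame g -> tame (fun x => f x + g x).
Proof.
move=> [mf [M [r Mr]]] [mg [N [s Ns]]]; split; first exact: measurable_funD.
exists (M + N), (Num.max r s) => x; split.
  by apply: le_trans (ler_normD _ _) _; rewrite lerD// ?(Mr x).1 ?(Ns x).1.
by rewrite gt_max => /andP[/(Mr x).2 -> /(Ns x).2 ->]; rewrite addr0.
Qed.

Lemma tameMl f g : measurable_fun [set: 'rV[R]_n] g ->
  (exists M, forall x, `|g x| <= M) -> tame f -> tame (fun x => g x * f x).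
Proof.
move=> mg [N Ng] [mf [M [r Mr]]]; split; first exact: measurable_funM.
exists (N * M), r => x; split; last by move=> /(Mr x).2 ->; rewrite mulr0.
by rewrite normrM ler_pM// (Mr x).1.
Qed.

Lemma tameM f g : tame f -> tame g -> tame (fun x => f x * g x).
Proof.
by move=> [mf [M [r Mr]]] tg; apply: tameMl => //; exists M => x; exact: (Mr x).1.
Qed.

Lemma tameZ c f : tame f -> tame (fun x => c * f x).
Proof. by apply: tameMl => //; exists `|c|. Qed.

Lemma tameB f g : tame f -> tame g -> tame (fun x => f x - g x).
Proof.
move=> tf tg; have := tameD tf (tameZ (-1) tg).
by under eq_fun do rewrite mulN1r.
Qed.

Lemma tameX2 f : tame f -> tame (fun x => f x ^+ 2).
Proof. by move=> tf; exact: (tameM tf tf). Qed.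

Lemma tame_sum J (s : seq J) (P : pred J) (F : J -> 'rV[R]_n -> R) :
  (forall i, tame (F i)) -> tame (fun x => \sum_(i <- s | P i) F i x).
Proof.
move=> tF; elim: s => [|i s IH].
  by under eq_fun do rewrite big_nil; exact: tame0.
under eq_fun do rewrite big_cons; case: (P i) => //; exact: tameD.
Qed.

Lemma tame_shift z f : tame f -> tame (fun x => f (x + z)).
Proof.
move=> [mf [M [r Mr]]]; split.
  exact: measurableT_comp mf (measurable_rVD z).
exists M, (r + `|z|) => x; split; first exact: (Mr _).1.
move=> rx; apply: (Mr _).2; rewrite -(ltrD2r `|z|); apply: lt_le_trans rx _.
by have := ler_normB (x + z) z; rewrite addrK.
Qed.

Lemma tame_indic A (r : R) : measurable A -> (forall x, A x -> `|x| <= r) ->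
  tame (\1_A).
Proof.
move=> mA Ar; split; first exact: measurable_indic.
exists 1, r => x; rewrite indicE; split; first by rewrite normr_nat lern1 leq_b1.
move=> rx; case: (boolP (x \in A)) => //; rewrite inE => /Ar.
by rewrite leNgt rx.
Qed.

Definition int_rV f : R := \int[mu]_x f x.

Lemma int_rVD f g : tame f -> tame g -> int_rV (fun x => f x + g x) = int_rV f + int_rV g.
Proof. by move=> tf tg; apply: RintegralD => //; exact: tame_integrable. Qed.

Lemma int_rVZ c f : tame f -> int_rV (fun x => c * f x) = c * int_rV f.
Proof. by move=> tf; apply: RintegralZl => //; exact: tame_integrable. Qed.

Lemma int_rVB f g : tame f -> tame g -> int_rV (fun x => f x - g x) = int_rV f - int_rV g.
Proof.
move=> tf tg; rewrite -mulN1r -int_rVZ// -int_rVD//; last exact: tameZ.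
by congr int_rV; apply/funext => x; rewrite mulN1r.
Qed.

Lemma int_rV0 : int_rV (fun=> 0) = 0.
Proof. by rewrite /int_rV /Rintegral integral0. Qed.

Lemma int_rV_sum J (s : seq J) (P : pred J) (F : J -> 'rV[R]_n -> R) :
  (forall i, tame (F i)) ->
  int_rV (fun x => \sum_(i <- s | P i) F i x) = \sum_(i <- s | P i) int_rV (F i).
Proof.
move=> tF; elim: s => [|i s IH].
  by under eq_fun do rewrite big_nil; rewrite int_rV0 big_nil.
rewrite big_cons; under eq_fun do rewrite big_cons; case: (P i) => //.
by rewrite int_rVD ?IH//; exact: tame_sum.
Qed.

Lemma int_rV_le f g : tame f -> tame g -> (forall x, f x <= g x) -> int_rV f <= int_rV g.
Proof.
by move=> tf tg fg; apply: le_Rintegral => //; exact: tame_integrable.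
Qed.

Lemma int_rV_ge0 f : (forall x, 0 <= f x) -> 0 <= int_rV f.
Proof. by move=> f0; apply: Rintegral_ge0. Qed.

Lemma int_rV_shift z f : tame f -> int_rV (fun x => f (x + z)) = int_rV f.
Proof.
move=> [mf _]; rewrite /int_rV /Rintegral; congr fine.
by rewrite (integral_rV_shift z (f := EFin \o f))//; exact/measurable_EFinP.
Qed.

Lemma int_rV_EFin f : tame f -> (\int[mu]_x (f x)%:E = (int_rV f)%:E)%E.
Proof.
by move=> tf; rewrite fineK//; apply: integrable_fin_num => //; exact: tame_integrable.
Qed.

Lemma int_rV_indic A (r : R) : measurable A -> (forall x, A x -> `|x| <= r) ->
  (int_rV (\1_A))%:E = mu A.
Proof.
by move=> mA Ar; rewrite -int_rV_EFin ?integral_indic ?setIT//; exact: tame_indic Ar.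
Qed.

(** Dominated convergence, with [M] times the indicator of the ball of radius [r] as dominating
    function. *)
Lemma int_rV_cvg (F : nat -> 'rV[R]_n -> R) f (M r : R) :
  (forall m, measurable_fun [set: 'rV[R]_n] (F m)) ->
  measurable_fun [set: 'rV[R]_n] f ->
  (forall m x, `|F m x| <= M /\ (r < `|x| -> F m x = 0)) ->
  (forall x, F m x @[m --> \oo] --> f x) ->
  int_rV (F m) @[m --> \oo] --> int_rV f.
Proof.
move=> mF mf Mr cF.
have mB := measurable_norm_le r.
have tg : tame (fun x => M * \1_[set x | `|x| <= r] x).
  by apply: tameZ; apply: (@tame_indic _ r).
have := @dominated_convergence _ _ _ mu setT measurableT
  (fun m => EFin \o F m) (EFin \o f) (fun x => (M * \1_[set x | `|x| <= r] x)%:E).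
case=> [m|||||fi _ h].
- exact/measurable_EFinP.
- exact/measurable_EFinP.
- by apply: aeW => x _; apply: cvg_EFin; [exact: nearW|exact: cF].
- exact: tame_integrable tg.
- apply: aeW => x m _; rewrite /= lee_fin indicE.
  have [h1 h2] := Mr m x.
  have [xr|xr] := leP `|x| r; first by rewrite mem_set ?mulr1.
  by rewrite h2// normr0 memNset /= ?mulr0//; apply/negP; rewrite -ltNge.
have tF m : tame (F m) by split; [exact: mF|exists M, r; exact: Mr].
move: h; rewrite (_ : (\int[mu]_x (EFin \o f) x)%E = (int_rV f)%:E); last first.
  by rewrite /int_rV /Rintegral fineK//; exact: integrable_fin_num.
rewrite (_ : [sequence _]_m = EFin \o (fun m => int_rV (F m))); last first.
  by apply/funext => m; exact: int_rV_EFin.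
by move=> /fine_cvgP[_].
Qed.

Lemma tame_continuous f (r : R) :
  continuous f -> (forall x, r < `|x| -> f x = 0) -> tame f.
Proof.
move=> cf D0; split.
  by apply: measurable_fun_rV_continuous => [|x _]; [exact: openT|exact: cf].
have [c _ cP] : exists2 c : 'rV[R]_n, True & forall x, `|x| <= r -> `|f x| <= `|f c|.
  have [r0|r0] := ltP r 0.
    by exists 0 => // x /le_lt_trans /(_ r0); rewrite ltNge normr_ge0.
  have [||c _ h] := @compact_EVT_max _ _ (fun x => `|f x|) _ _ (@compact_norm_le r).
  - by exists 0; rewrite /= normr0.
  - apply: continuous_subspaceT => x.
    exact: (cvg_norm (cf x)).
  - by exists c => // x xr; apply: h; rewrite inE.
exists `|f c|, r => x; split; last exact: D0.
by have [/cP|/D0 ->] := leP `|x| r; rewrite ?normr0.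
Qed.

End tame.

(** Lagrange's identity: twice the difference of the two sides is the double sum of the squares of
    [a i * b j - a j * b i]. *)
Lemma sum_CauchySchwarz (R : realFieldType) J (r : seq J) (a b : J -> R) :
  (\sum_(i <- r) a i * b i) ^+ 2 <=
  (\sum_(i <- r) a i ^+ 2) * (\sum_(i <- r) b i ^+ 2).
Proof.
have : 0 <= \sum_(i <- r) \sum_(j <- r) (a i * b j - a j * b i) ^+ 2.
  by do 2!apply: sumr_ge0 => ? _; exact: sqr_ge0.
rewrite (_ : \sum_(i <- r) _ = 2 * ((\sum_(i <- r) a i ^+ 2) *
   (\sum_(i <- r) b i ^+ 2) - (\sum_(i <- r) a i * b i) ^+ 2)).
  by rewrite pmulr_rge0// subr_ge0.
transitivity (\sum_(i <- r) \sum_(j <- r) (a i ^+ 2 * b j ^+ 2) +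
  \sum_(i <- r) \sum_(j <- r) (b i ^+ 2 * a j ^+ 2) -
  2 * \sum_(i <- r) \sum_(j <- r) (a i * b i * (a j * b j))).
  rewrite mulr_sumr -sumrN -!big_split; apply: eq_bigr => i _ /=.
  rewrite mulr_sumr -sumrN -!big_split; apply: eq_bigr => j _ /=; ring.
rewrite -!big_distrlr /=; ring.
Qed.

Lemma sqr_sum_le (R : realFieldType) (k : nat) (a : 'I_k -> R) :
  (\sum_i a i) ^+ 2 <= k%:R * \sum_i a i ^+ 2.
Proof.
have := sum_CauchySchwarz (index_enum 'I_k) (fun=> 1) a.
under eq_bigr do rewrite mul1r.
under [X in _ <= X * _ -> _]eq_bigr do rewrite expr1n.
by rewrite sumr_const card_ord.
Qed.

(** * Directional derivatives and translations *)

Section directional.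
Context {R : realType} {V : normedModType R}.
Implicit Types (f : V -> R) (x v : V).

(** [is_Ck] provides partial derivatives, not differentials. Restricting to the line [x + t v]
    reduces the chain rule and the mean value theorem along [v] to functions of one real
    variable. *)
Lemma is_derive_slice f x v (t : R) : derivable f (x + t *: v) v ->
  is_derive t 1 (fun s => f (x + s *: v)) ('D_v f (x + t *: v)).
Proof.
move=> df.
have E : (fun h => h^-1 *: (((fun s => f (x + s *: v)) \o shift t) (h *: (1 : R)) - f (x + t *: v)))
    = (fun h => h^-1 *: ((f \o shift (x + t *: v)) (h *: v) - f (x + t *: v))).
  apply/funext => h /=; congr (_ *: (f _ - _)).
  by rewrite scalerDl [h *: 1]mulr1 addrCA.
by split; rewrite /derivable /derive E.
Qed.

Lemma is_derive_slice0 f x v (df : R) :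
  is_derive (0 : R) 1 (fun s => f (x + s *: v)) df -> is_derive x v f df.
Proof.
have E : (fun h => h^-1 *: (((fun s => f (x + s *: v)) \o shift 0) (h *: (1 : R)) - f (x + 0 *: v)))
    = (fun h => h^-1 *: ((f \o shift x) (h *: v) - f x)).
  apply/funext => h /=; rewrite scale0r addr0 [h *: 1]mulr1 addr0.
  by rewrite [x + _]addrC.
by case; rewrite /derivable /derive E.
Qed.

Lemma is_derive_dirZ f x v (s df : R) :
  is_derive x v f df -> is_derive x (s *: v) f (s * df).
Proof.
move=> [fx <-]; apply: is_derive_slice0; rewrite mulrC.
have -> : (fun t : R => f (x + t *: (s *: v))) = (fun t => f (x + t *: v)) \o ( *%R^~ s).
  by apply/funext => t /=; rewrite scalerA.
apply: is_derive1_comp.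
  by rewrite mul0r; have := @is_derive_slice f x v 0; rewrite scale0r addr0; apply.
have -> : *%R^~ s = s \*: (@id R) by apply/funext => t /=; rewrite mulrC.
by rewrite -[X in is_derive _ _ _ X]mulr1; exact: is_deriveZ.
Qed.

Lemma is_derive_comp f (g : R -> R) x v (df dg : R) :
  is_derive x v f df -> is_derive (f x) 1 g dg ->
  is_derive x v (g \o f) (df * dg).
Proof.
move=> [fx <-] hg.
have h : is_derive (0 : R) 1 (fun s => f (x + s *: v)) ('D_v f x).
  by have := @is_derive_slice f x v 0; rewrite scale0r addr0; apply.
have hg' : is_derive (f (x + 0 *: v)) 1 g dg by rewrite scale0r addr0.
by apply: is_derive_slice0; rewrite mulrC; exact: is_derive1_comp hg' h.
Qed.

Lemma MVT_norm f x v (t K : R) :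
  (forall s, 0 <= s <= t -> derivable f (x + s *: v) v) ->
  (forall s, 0 <= s <= t -> `|'D_v f (x + s *: v)| <= K) -> 0 <= t ->
  `|f (x + t *: v) - f x| <= K * t.
Proof.
move=> df bf; rewrite le_eqVlt => /predU1P[<-|t0].
  by rewrite scale0r addr0 subrr normr0 mulr0.
have H s : 0 <= s <= t -> is_derive s 1 (fun s => f (x + s *: v)) ('D_v f (x + s *: v)).
  by move=> /df; exact: is_derive_slice.
have [||c] := @MVT _ (fun s => f (x + s *: v)) (fun s => 'D_v f (x + s *: v)) 0 t t0.
- by move=> s; rewrite in_itv /= => /andP[s0 st]; apply: H; rewrite !ltW.
- apply: derivable_within_continuous => s; rewrite in_itv /= => /H[+ _]; exact.
rewrite in_itv /= scale0r addr0 subr0 => /andP[c0 ct] /= ->.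
rewrite normrM (gtr0_norm t0); apply: ler_wpM2r; first exact: ltW.
by apply: bf; rewrite !ltW.
Qed.

Lemma cvg_diffquot f x v : derivable f x v ->
  m.+1%:R * (f (x + m.+1%:R^-1 *: v) - f x) @[m --> \oo] --> 'D_v f x.
Proof.
move=> df.
have c0 : m.+1%:R^-1 @[m --> \oo] --> (0 : R)^'.
  move=> A /= A0.
  have h : \forall m \near \oo, (harmonic m : R) != 0 -> A (harmonic m).
    exact: (@cvg_harmonic R _ A0).
  change (\forall m \near \oo, A (harmonic m : R)).
  by apply: filterS h => m; apply; rewrite invr_eq0 pnatr_eq0.
have := cvg_comp _ _ c0 df; apply: cvg_trans.
rewrite (_ : (fun m => _) = (fun h => h^-1 *: ((f \o shift x) (h *: v) - f x)) \o
   (fun m => m.+1%:R^-1)) //.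
by apply/funext => m /=; rewrite invrK [_ + x]addrC.
Qed.

End directional.

Section diffquot.
Context {R : realType} {n : nat}.
Implicit Types (f : 'rV[R]_n -> R) (v : 'rV[R]_n).

(** [C^1] with bounded support, but in the single direction [v]. *)
Definition C1c v f := [/\ tame f, forall x, derivable f x v,
  continuous ('D_v f) & exists r : R, forall x, r < `|x| -> f x = 0].

Lemma C1c_tameD v f : C1c v f -> tame ('D_v f).
Proof.
move=> [_ df cf [r fr]]; apply: (tame_continuous cf (r := r)) => x rx.
rewrite (@near_eq_derive _ _ _ f (cst 0)) ?derive_cst//.
have := @cvgr_gt _ _ _ _ _ _ (@norm_continuous _ _ x) _ rx => /(_ _).
by apply: filterS => y /fr ->.
Qed.

(** The mean value theorem bounds the difference quotients by the supremum of the derivative, and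
    [g 0 = 0] keeps the support bounded, so dominated convergence applies. It is used with [g] the
    identity, for the divergence theorem, and with [g] the square, for the translation estimate. *)
Lemma C1c_diffquot v f (g : R -> R) : C1c v f -> continuous g -> g 0 = 0 ->
  int_rV (fun x => g (m.+1%:R * (f (x + m.+1%:R^-1 *: v) - f x))) @[m --> \oo] -->
  int_rV (fun x => g ('D_v f x)).
Proof.
move=> Cf cg g0; have [tf df cf [r fr]] := Cf.
have [mDf [K [s Ks]]] := C1c_tameD Cf.
have K0 : 0 <= K by apply: le_trans (Ks 0).1.
have dqK m x : `|m.+1%:R * (f (x + m.+1%:R^-1 *: v) - f x)| <= K.
  rewrite normrM normr_nat mulrC -ler_pdivlMr ?ltr0n//.
  by apply: MVT_norm => // t _; exact: (Ks _).1.
have [M gM] : exists M, forall t, `|t| <= K -> `|g t| <= M.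
  have KK : - K <= K by rewrite ge0_cp.
  have [|||c _ h] := @compact_EVT_max _ _ (fun t => `|g t|) `[- K, K]%classic.
  - by exists 0; rewrite /= in_itv /= K0 oppr_le0 K0.
  - exact: segment_compact.
  - apply: continuous_subspaceT => x.
    exact: (cvg_norm (cg x)).
  - by exists `|g c| => t tK; apply: h; rewrite inE /= in_itv /= -ler_norml.
have mg : measurable_fun [set: R] g by exact: continuous_measurable_fun.
apply: (@int_rV_cvg _ _ _ _ M (r + `|v|)).
- move=> m; apply: measurableT_comp => //; apply: measurable_funM => //.
  apply: measurable_funB => //; last by case: tf.
  by have [] := tame_shift (m.+1%:R^-1 *: v) tf.
- exact: measurableT_comp.
- move=> m x; split; first exact: gM.
  move=> rvx; rewrite !fr ?subrr ?mulr0//.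
    by apply: le_lt_trans rvx; rewrite lerDl.
  rewrite -(ltrD2r `|v|); apply: lt_le_trans rvx _.
  have := ler_normB (x + m.+1%:R^-1 *: v) (m.+1%:R^-1 *: v); rewrite addrK.
  move=> /le_trans; apply; rewrite lerD2l normrZ ger0_norm// ler_piMl//.
  by rewrite invf_le1 ?ltr0n// ler1n.
- move=> x; apply: continuous_cvg; first exact: cg.
  exact: cvg_diffquot.
Qed.

(* The difference quotients have integral 0 by translation invariance, which avoids
   integrating by parts coordinate by coordinate. *)
Lemma C1c_integral_derive v f : C1c v f -> int_rV ('D_v f) = 0.
Proof.
move=> Cf; have [tf df cf [r fr]] := Cf.
have := @C1c_diffquot v f id Cf (fun x => cvg_id) erefl.
rewrite (_ : (fun m => _) = cst 0); last first.
  apply/funext => m /=; rewrite int_rVZ; last first.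
    by apply: tameB => //; exact: tame_shift.
  by rewrite int_rVB ?int_rV_shift ?subrr ?mulr0//; exact: tame_shift.
by move=> /cvg_lim <-//; rewrite lim_cst.
Qed.

Lemma int_rV_sqr_sum (k : nat) (F : 'I_k -> 'rV[R]_n -> R) :
  (forall i, tame (F i)) ->
  int_rV (fun x => (\sum_i F i x) ^+ 2) <= k%:R * \sum_i int_rV (fun x => F i x ^+ 2).
Proof.
move=> tF; have tF2 i : tame (fun x => F i x ^+ 2) by exact: tameX2.
rewrite -int_rV_sum// -int_rVZ; last exact: tame_sum.
apply: int_rV_le => [||x]; [exact/tameX2/tame_sum|exact/tameZ/tame_sum|].
exact: sqr_sum_le.
Qed.

Lemma C1c_translation v f (s : R) : C1c v f ->
  int_rV (fun x => (f (x + s *: v) - f x) ^+ 2) <= s ^+ 2 * int_rV (fun x => 'D_v f x ^+ 2).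
Proof.
move=> Cf; have [tf df cf [r fr]] := Cf.
have dsf x : is_derive x (s *: v) f (s * 'D_v f x).
  by apply: is_derive_dirZ; exact/derivableP.
have Dsf : 'D_(s *: v) f = (fun x => s * 'D_v f x).
  by apply/funext => x; exact: derive_val.
(* The derivative is homogeneous in its direction, so the length [s] can be absorbed into
   [w = s v]. *)
suff H w : C1c w f -> int_rV (fun x => (f (x + w) - f x) ^+ 2) <= int_rV (fun x => 'D_w f x ^+ 2).
  apply: le_trans (H (s *: v) _) _; last first.
    rewrite -int_rVZ; last exact/tameX2/C1c_tameD.
    rewrite [X in int_rV X <= _](_ : _ = (fun x => s ^+ 2 * 'D_v f x ^+ 2))//.
    by apply/funext => x; rewrite derive_val exprMn.
  split=> //; last by exists r.
  by rewrite Dsf => x; exact: (cvgM (cvg_cst s) (cf x)).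
move=> Cw; have g2 : continuous (fun t : R => t ^+ 2) by exact: exprn_continuous.
(* Cut [w] into [m.+1] equal steps, which all contribute the same integral by
   translation invariance, and let [m] tend to infinity. *)
have := C1c_diffquot Cw g2 (expr0n _ 2).
move=> lim; rewrite -(cvg_lim _ lim)//; apply: limr_ge; first by apply/cvg_ex; eexists; exact: lim.
apply: nearW => m; set c : R := m.+1%:R.
have c0 : c != 0 by rewrite pnatr_eq0.
pose F (k : 'I_m.+1) x := f (x + k%:R *: (c^-1 *: w) + c^-1 *: w) - f (x + k%:R *: (c^-1 *: w)).
have tfw : tame (fun x => f (x + c^-1 *: w) - f x) by apply: tameB => //; exact: tame_shift.
have tF k : tame (F k) by exact: (tame_shift (k%:R *: (c^-1 *: w)) tfw).
have E x : f (x + w) - f x = \sum_k F k x.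
  rewrite /F -(big_mkord xpredT (fun k =>
    f (x + k%:R *: (c^-1 *: w) + c^-1 *: w) - f (x + k%:R *: (c^-1 *: w)))).
  transitivity (\sum_(0 <= k < m.+1) (f (x + k.+1%:R *: (c^-1 *: w)) - f (x + k%:R *: (c^-1 *: w)))).
    by rewrite telescope_sumr// scale0r addr0 scalerA mulfV// scale1r.
  by apply: eq_bigr => k _; rewrite -natr1 scalerDl scale1r addrA.
under eq_fun do rewrite E; apply: le_trans (int_rV_sqr_sum tF) _.
have -> : (fun x => (c * (f (x + c^-1 *: w) - f x)) ^+ 2) =
    (fun x => c ^+ 2 * (f (x + c^-1 *: w) - f x) ^+ 2).
  by apply/funext => x; rewrite exprMn.
rewrite int_rVZ; last exact: tameX2.
(* The factor [m.+1] of Cauchy-Schwarz and the [m.+1] equal terms together give [c ^ 2], the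
   normalization of the squared difference quotient. *)
under eq_bigr => k _ do rewrite (int_rV_shift (k%:R *: (c^-1 *: w)) (tameX2 tfw)).
by rewrite sumr_const card_ord -[X in _ * X]mulr_natl mulrA -expr2.
Qed.

End diffquot.

Section coordinate_path.
Context {R : realType} {n : nat}.
Implicit Types (x z : 'rV[R]_n).

(** The corners of a path from [x] to [x + z] with edges parallel to the axes, along which partial
    derivatives are enough. *)
Definition staircase x z (k : nat) : 'rV[R]_n :=
  x + \row_j (if (j < k)%N then z 0 j else 0).

Lemma staircase0 x z : staircase x z 0 = x.
Proof. by apply/rowP => j; rewrite !mxE addr0. Qed.

Lemma staircaseS x z (k : 'I_n) :
  staircase x z k.+1 = staircase x z k + z 0 k *: delta_mx 0 k.
Proof.
apply/rowP => j; rewrite !mxE ltnS leq_eqVlt eqxx /= -addrA; congr (_ + _).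
rewrite (_ : (nat_of_ord j == k) = (j == k))//.
by have [->|jk] := eqVneq j k; rewrite ?ltnn ?mulr1 ?add0r// mulr0 addr0.
Qed.

Lemma staircase_size x z : staircase x z n = x + z.
Proof. by apply/rowP => j; rewrite !mxE ltn_ord. Qed.

Lemma staircase_telescope (f : 'rV[R]_n -> R) x z :
  f (x + z) - f x = \sum_(i < n)
    (f (staircase x z i + z 0 i *: delta_mx 0 i) - f (staircase x z i)).
Proof.
under eq_bigr do rewrite -staircaseS.
rewrite -(big_mkord xpredT (fun i => f (staircase x z i.+1) - f (staircase x z i))).
by rewrite telescope_sumr// staircase0 staircase_size.
Qed.

End coordinate_path.

(** * The Faber-Krahn inequality *)

Section faber_krahn.
Context {R : realType} {n : nat}.
Variables (f : 'rV[R]_n -> R) (A : set 'rV[R]_n) (r h : R).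
Hypotheses (Cf : forall i, C1c (delta_mx 0 i) f) (tf : tame f).
Hypotheses (mA : measurable A) (Ar : forall x, A x -> `|x| <= r).
Hypotheses (fA : forall x, ~ A x -> f x = 0).
Hypotheses (h0 : 0 < h) (Ah : 4 * int_rV (\1_A : 'rV[R]_n -> R) <= h ^+ n).

Let G := \sum_(i < n) int_rV (fun x => partial i f x ^+ 2).

(** The [i]-th corner of the staircase is [x + y i] with [y i] independent of [x], so translation
    invariance moves each edge back to [x]. Cauchy-Schwarz over the [n] edges costs the factor
    [n]. *)
Let translation_le z : cube h z ->
  int_rV (fun x => (f (x + z) - f x) ^+ 2) <= n%:R * (h ^+ 2 * G).
Proof.
move=> zh; pose y i := \row_j (if (j < i)%N then z 0 j else 0) : 'rV[R]_n.
pose F (i : 'I_n) x := f (x + z 0 i *: delta_mx 0 i) - f x.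
have tF i : tame (F i) by apply: tameB => //; exact: tame_shift.
under eq_fun do rewrite staircase_telescope.
have := int_rV_sqr_sum (F := fun i x => F i (x + y i)) (fun i => tame_shift (y i) (tF i)).
move=> /le_trans; apply; rewrite ler_wpM2l// mulr_sumr ler_sum// => i _.
rewrite (int_rV_shift (y i) (tameX2 (tF i))).
apply: le_trans (C1c_translation _ (Cf i)) _.
have /andP[z0 zi] := zh i.
rewrite ler_wpM2r//; first by apply: int_rV_ge0 => x; exact: sqr_ge0.
by rewrite ler_sqr ?nnegrE// ltW.
Qed.

(** The set [A] fills at most a quarter of the volume of the cube. Hence, averaged over translations
    in the cube, [2 int_A f (x + z) ^ 2] is at most [S / 2] and can be absorbed:
    [S <= 2 c1 + S / 2]. *)
Lemma faber_krahn : int_rV (fun x => f x ^+ 2) <= 4 * (n%:R * (h ^+ 2 * G)).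
Proof.
set c1 := n%:R * (h ^+ 2 * G); set S := int_rV (fun x => f x ^+ 2).
have S0 : 0 <= S by apply: int_rV_ge0 => x; exact: sqr_ge0.
have tf2 := tameX2 tf.
have tA := tame_indic mA Ar.
have tAz z : tame (fun x => \1_A x * f (x + z) ^+ 2).
  by apply: tameM => //; exact: (tame_shift z tf2).
(* [f x ^+ 2 <= 2 (f (x + z) - f x) ^+ 2 + 2 1_A(x) f (x + z) ^+ 2], to be averaged over
   the [z] in the cube of side [h]. *)
have key z : cube h z -> S - 2 * c1 <= 2 * int_rV (fun x => \1_A x * f (x + z) ^+ 2).
  move=> zh; have td : tame (fun x => (f (x + z) - f x) ^+ 2).
    by apply/tameX2/tameB => //; exact: tame_shift.
  rewrite lerBlDr addrC; apply: (@le_trans _ _ (2 * int_rV (fun x => (f (x + z) - f x) ^+ 2) +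
    2 * int_rV (fun x => \1_A x * f (x + z) ^+ 2))); last first.
    by rewrite lerD2r ler_wpM2l// translation_le.
  rewrite -!int_rVZ// -int_rVD; [|exact: tameZ..].
  apply: int_rV_le => [//||x]; first by apply: tameD; exact: tameZ.
  have [Ax|Ax] := pselect (A x).
    rewrite indicE mem_set// mul1r -subr_ge0.
    rewrite (_ : _ - _ = (2 * f (x + z) - f x) ^+ 2) ?sqr_ge0//; ring.
  by rewrite fA// indicE memNset// mul0r mulr0 addr0 expr0n /= mulr_ge0// sqr_ge0.
(* The lower bound that is integrated over the cube has to be nonnegative; in the other case
   [S <= 2 c1] is already more than enough. *)
have [c0|c0] := leP (S - 2 * c1) 0.
  suff : 0 <= c1 by lra.
  apply: mulr_ge0 => //; apply: mulr_ge0; first exact: sqr_ge0.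
  apply: sumr_ge0 => i _.
  by apply: int_rV_ge0 => x; exact: sqr_ge0.
pose g (p : 'rV[R]_n * 'rV[R]_n) : R :=
  2 * (\1_(cube h) p.1 * (\1_A p.2 * f (p.2 + p.1) ^+ 2)).
have g0 p : 0 <= g p.
  by rewrite /g; do 3 (apply: mulr_ge0 => //); exact: sqr_ge0.
have mg : measurable_fun setT (EFin \o g).
  apply/measurable_EFinP; apply: measurable_funM => //; apply: measurable_funM.
    have mc := measurable_indic (R := R) (D := setT) (@measurable_cube R n h).
    exact: measurableT_comp mc measurable_fst.
  apply: measurable_funM.
    have mc := measurable_indic (R := R) (D := setT) mA.
    exact: measurableT_comp mc measurable_snd.
  apply: measurable_funX; apply: measurableT_comp; first by case: tf.
  apply: measurable_fun_rV => i /=; under eq_fun do rewrite mxE.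
  apply: measurable_funD.
    exact: measurableT_comp (measurable_rV_coord i) measurable_snd.
  exact: measurableT_comp (measurable_rV_coord i) measurable_fst.
have mcube := @measurable_cube R n h.
have lower : (((S - 2 * c1) * h ^+ n)%:E <=
    \int[lebesgue_rV R n]_z \int[lebesgue_rV R n]_x (EFin \o g) (z, x))%E.
  have -> : ((S - 2 * c1) * h ^+ n)%:E =
      (\int[lebesgue_rV R n]_z ((S - 2 * c1) * \1_(cube h) z)%:E)%E.
    under eq_integral do rewrite EFinM.
    rewrite ge0_integralZl_EFin//; [|exact: measurable_EFin_indic|exact: ltW].
    rewrite integral_indic// setIT EFinM; congr (_ * _)%E.
    by apply/esym; apply: lebesgue_rV_cube; exact: ltW.
  apply: ge0_le_integral => //.
  - move=> z _; rewrite lee_fin mulr_ge0//; exact: ltW.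
  - by apply/measurable_EFinP; apply: measurable_funM => //; exact: measurable_indic.
  - exact: (@measurable_fun_fubini_tonelli_F _ _ _ _ _ (lebesgue_rV R n) _ mg (fun p => g0 _)).
  - move=> z _; rewrite /g /=; have [zh|zh] := pselect (cube h z); last first.
      rewrite indicE memNset// mulr0; apply: integral_ge0 => x _.
      by rewrite lee_fin mul0r mulr0.
    rewrite indicE mem_set// mulr1.
    under eq_integral do rewrite mul1r.
    rewrite (int_rV_EFin (f := fun x => 2 * (\1_A x * f (x + z) ^+ 2))); last exact: tameZ.
    by rewrite lee_fin int_rVZ// key.
(* With [z] as inner variable, the cube may be enlarged to the whole space, where translation
   invariance turns the inner integral into a multiple of [S]. *)
have upper : (\int[lebesgue_rV R n]_z \int[lebesgue_rV R n]_x (EFin \o g) (z, x) <=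
    (2 * S * int_rV (\1_A : 'rV[R]_n -> R))%:E)%E.
  rewrite fubini_tonelli//.
  rewrite -int_rVZ// -(int_rV_EFin (f := fun x => 2 * S * \1_A x)); last exact: tameZ.
  apply: ge0_le_integral => //.
  - by move=> x _; apply: integral_ge0 => z _; rewrite lee_fin.
  - exact: (@measurable_fun_fubini_tonelli_G _ _ _ _ _ (lebesgue_rV R n) _ mg (fun p => g0 _)).
  - by apply/measurable_EFinP; apply: measurable_funM => //; exact: measurable_indic.
  - move=> x _; have tz : tame (fun z => 2 * \1_A x * f (z + x) ^+ 2).
      by apply: tameZ; exact: (tame_shift x tf2).
    have -> : (2 * S * \1_A x)%:E = (\int[lebesgue_rV R n]_z (2 * \1_A x * f (z + x) ^+ 2)%:E)%E.
      rewrite (int_rV_EFin tz) int_rVZ; last exact: (tame_shift x tf2).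
      by rewrite (int_rV_shift x tf2) mulrAC.
    apply: ge0_le_integral => //.
    + by move=> z _; rewrite lee_fin.
    + exact: measurableT_comp mg (measurable_pair2 x).
    + by apply/measurable_EFinP; case: tz.
    + move=> z _; rewrite lee_fin /g /= addrC -mulrA ler_wpM2l//.
      apply: ler_piMl; first by rewrite mulr_ge0// sqr_ge0.
      by rewrite indicE lern1 leq_b1.
have := le_trans lower upper; rewrite lee_fin => H.
have hn : 0 < h ^+ n by exact: exprn_gt0.
suff : S - 2 * c1 <= S / 2 by lra.
rewrite -(ler_pM2r hn); apply: le_trans H _.
have := ler_wpM2l S0 Ah; rewrite !mulrA => H2.
set w := h ^+ n in H2 *; set u := int_rV _ in H2 *.
have : 2 * S * u * 2 <= S * w by rewrite (_ : _ * 2 = S * 4 * u) //; ring.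
by rewrite [S / 2 * w]mulrAC ler_pdivlMr.
Qed.

End faber_krahn.

(** * Truncation, energy estimate and De Giorgi iteration *)

Section positive_part_sqr.
Context {R : realType}.

(** The square removes the kink: at [s = k] an increment [h] changes the value by at most
    [h ^ 2]. *)
Lemma is_derive_maxr_sqr (k s : R) :
  is_derive s 1 (fun t : R => Num.max (t - k) 0 ^+ 2) (2 * Num.max (s - k) 0).
Proof.
have [sk|ks|->] := ltgtP s k.
- rewrite (@max_r _ _ (s - k)) ?mulr0; last by rewrite subr_le0 ltW.
  have E : \forall t \near s, cst 0 t = Num.max (t - k) 0 ^+ 2 :> R.
    near=> t; rewrite max_r ?expr0n//= subr_le0 ltW//; near: t; exact: lt_nbhsl.
  exact: near_eq_is_derive E (is_derive_cst _ _ _).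
- rewrite (@max_l _ _ (s - k)); last by rewrite subr_ge0 ltW.
  have E : \forall t \near s, (fun t => (t - k) ^+ 2) t = Num.max (t - k) 0 ^+ 2 :> R.
    near=> t; rewrite max_l// subr_ge0 ltW//; near: t; exact: lt_nbhsr.
  apply: near_eq_is_derive E _.
  have -> : (fun t : R => (t - k) ^+ 2) = (fun t => (id - cst k) t ^+ 2) by [].
  have h1 : is_derive s 1 (id - cst k) (1 - 0 : R) by exact: is_deriveB.
  apply: is_derive_eq (is_deriveX 2 h1) _.
  by rewrite subr0 expr1 /= [_ *: 1]mulr1.
- rewrite subrr maxxx mulr0.
  have lim : h^-1 *: (((fun t : R => Num.max (t - k) 0 ^+ 2) \o shift k) (h *: (1 : R)) -
      Num.max (k - k) 0 ^+ 2) @[h --> (0 : R)^'] --> (0 : R).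
    apply/cvgr0Pnorm_lt => e e0; near=> h => /=.
    have h0 : h != 0 by near: h; exact: nbhs_dnbhs_neq.
    rewrite [h *: 1]mulr1 addrK subrr maxxx expr0n subr0 normrZ normfV ltr_pdivrMl ?normr_gt0//.
    apply: (@le_lt_trans _ _ (`|h| * `|h|)).
      rewrite -expr2 -normrX ger0_norm ?sqr_ge0// [leRHS]ger0_norm ?sqr_ge0//.
      by case: (leP h 0) => _; rewrite // expr0n sqr_ge0.
    rewrite ltr_pM2l ?normr_gt0//; near: h; exact: dnbhs0_lt.
  by split; [apply/cvg_ex; exists 0|exact/cvg_lim].
Unshelve. all: by end_near. Qed.

Lemma continuous_maxr (k : R) : continuous (fun t : R => Num.max (t - k) 0).
Proof.
move=> s; apply: (@continuous_max _ _ (fun t : R => t - k) (fun=> 0 : R)).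
  by apply: cvgB; [exact: cvg_id|exact: cvg_cst].
exact: cvg_cst.
Qed.

End positive_part_sqr.

Lemma near_eq_cvg_to (T U : topologicalType) (f g : T -> U) (x : T) (l : U) :
  (\forall y \near x, f y = g y) -> g y @[y --> x] --> l -> f y @[y --> x] --> l.
Proof.
move=> fg; apply: cvg_trans; apply: near_eq_cvg; near=> y => /=.
by apply/esym; near: y.
Unshelve. all: by end_near. Qed.

(** * Extension by zero of functions that vanish near the boundary *)

Section extension.
Context {R : realType} {n : nat}.
Variables (D : set 'rV[R]_n) (u : 'rV[R]_n -> R) (k r : R).
Hypotheses (oD : open D) (Dr : forall x, D x -> `|x| <= r) (k0 : 0 < k).
Hypotheses (cu : {within closure D, continuous u})
  (cuD : forall x, D x -> {for x, continuous u})
  (u0 : forall x, (closure D `\` D) x -> u x = 0).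

Definition ext0 (g : 'rV[R]_n -> R) : 'rV[R]_n -> R :=
  fun x => if x \in D then g x else 0.

Lemma ext0_in g x : D x -> ext0 g x = g x.
Proof. by move=> Dx; rewrite /ext0 mem_set. Qed.

Lemma ext0_notin g x : ~ D x -> ext0 g x = 0.
Proof. by move=> Dx; rewrite /ext0 memNset. Qed.

Lemma near_ext0_in g x : D x -> \forall y \near x, ext0 g y = g y.
Proof.
by move=> Dx; near=> y; apply: ext0_in; near: y; exact: open_nbhs_nbhs.
Unshelve. all: by end_near. Qed.

(** A point outside [D] either has a neighbourhood disjoint from [D] or lies on the boundary, where
    [u] is 0 and stays below [k] nearby. Here the boundary condition and the continuity on the
    closure enter. *)
Lemma near_lt_notin x : ~ D x -> \forall y \near x, D y -> u y < k.
Proof.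
move=> Dx; have [cDx|cDx] := pselect (closure D x); last first.
  have : open_nbhs x (~` closure D).
    by split=> //; rewrite openC; exact: closed_closure.
  move/open_nbhs_nbhs; apply: filterS => y cDy Dy; exfalso; apply: cDy.
  exact: subset_closure.
have ux : u x < k by rewrite u0.
have /subspace_continuousP/(_ x cDx) h := cu.
have := @cvgr_lt _ _ _ _ _ _ h _ ux => /(_ _).
rewrite near_withinE; apply: filterS => y Hy Dy.
by apply: Hy; exact: subset_closure.
Qed.

Lemma near_ext0_notin g x : (forall y, D y -> u y < k -> g y = 0) ->
  ~ D x -> \forall y \near x, ext0 g y = 0.
Proof.
move=> gu /near_lt_notin; apply: filterS => y Hy; rewrite /ext0.
by case: ifPn => //; rewrite inE => Dy; apply: gu => //; exact: Hy.
Qed.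

Lemma continuous_ext0 g : (forall y, D y -> u y < k -> g y = 0) ->
  (forall x, D x -> {for x, continuous g}) -> continuous (ext0 g).
Proof.
move=> gu cg x; have [Dx|Dx] := pselect (D x).
  rewrite /continuous_at ext0_in//.
  exact: near_eq_cvg_to (near_ext0_in g Dx) (cg x Dx).
rewrite /continuous_at ext0_notin//.
apply: (@near_eq_cvg_to _ R (ext0 g) (fun=> 0) x 0); last exact: (@cvg_cst R 0 _ (nbhs x) _).
exact: near_ext0_notin gu Dx.
Qed.

Lemma tame_ext0 g : (forall y, D y -> u y < k -> g y = 0) ->
  (forall x, D x -> {for x, continuous g}) -> tame (ext0 g).
Proof.
move=> gu cg; apply: (@tame_continuous _ _ _ r); first exact: continuous_ext0.
by move=> x rx; apply: ext0_notin => /Dr; rewrite leNgt rx.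
Qed.

(** Around each point outside [D] the extension is identically 0, so it is as smooth as [g] is
    inside [D], whatever [g] does at the boundary. The derivative [dg] inherits the vanishing
    because [u < k] is an open condition in [D]. *)
Lemma C1c_ext0 g dg v : (forall y, D y -> u y < k -> g y = 0) ->
  (forall x, D x -> {for x, continuous g}) ->
  (forall x, D x -> is_derive x v g (dg x)) ->
  (forall x, D x -> {for x, continuous dg}) ->
  C1c v (ext0 g) /\ 'D_v (ext0 g) = ext0 dg.
Proof.
move=> gu cg hd cdg.
have dgu y : D y -> u y < k -> dg y = 0.
  move=> Dy uy; rewrite -(derive_val (is_derive := hd y Dy)).
  rewrite (@near_eq_derive _ _ _ _ (cst 0)) ?derive_cst//.
  near=> z; apply: gu; near: z; first exact: (open_nbhs_nbhs (conj oD Dy)).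
  exact: (@cvgr_lt _ _ _ _ _ _ (cuD Dy) _ uy).
have hx x : is_derive x v (ext0 g) (ext0 dg x).
  have [Dx|Dx] := pselect (D x).
    rewrite ext0_in//; apply: near_eq_is_derive (hd _ Dx).
    by apply: filterS (near_ext0_in g Dx) => y ->.
  rewrite ext0_notin//; apply: (@near_eq_is_derive _ _ _ (cst 0)).
  by apply: filterS (near_ext0_notin gu Dx) => y ->.
have Dext : 'D_v (ext0 g) = ext0 dg by apply/funext => x; exact: derive_val.
split=> //; split; first exact: tame_ext0.
- by move=> x; exact: ex_derive.
- by rewrite Dext; exact: continuous_ext0.
- by exists r => x rx; apply: ext0_notin => /Dr; rewrite leNgt rx.
Unshelve. all: by end_near. Qed.

End extension.

Section pointwise_derive.
Context {R : realType} {V : normedModType R}.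
Implicit Types (f g : V -> R) (x v : V).

Lemma is_derive_mul f g x v df dg :
  is_derive x v f df -> is_derive x v g dg ->
  is_derive x v (fun y => f y * g y) (df * g x + f x * dg).
Proof.
move=> hf hg; apply: is_derive_eq (is_deriveM hf hg) _.
by rewrite addrC; congr (_ + _); exact: mulrC.
Qed.

Lemma is_derive_fsum k (h : 'I_k -> V -> R) x v (dh : 'I_k -> R) :
  (forall i, is_derive x v (h i) (dh i)) ->
  is_derive x v (fun y => \sum_i h i y) (\sum_i dh i).
Proof.
move=> H; rewrite (_ : (fun y => _) = \sum_i h i); first exact: is_derive_sum.
by apply/funext => y; rewrite fct_sumE.
Qed.

Lemma continuous_const (c : R) x : {for x, continuous (fun=> c : R)}.
Proof. exact: (@cvg_cst R c _ (nbhs x) _). Qed.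

Lemma continuous_fsum k (h : 'I_k -> V -> R) x :
  (forall i, {for x, continuous (h i)}) ->
  {for x, continuous (fun y => \sum_i h i y)}.
Proof.
move=> H; rewrite /prop_for /continuous_at.
elim: (index_enum _) => [|i s IH].
  by under eq_fun do rewrite big_nil; rewrite big_nil; exact: continuous_const.
under eq_fun do rewrite big_cons; rewrite big_cons; apply: cvgD => //; exact: H.
Qed.

Lemma continuous_mul f g x : {for x, continuous f} -> {for x, continuous g} ->
  {for x, continuous (fun y => f y * g y)}.
Proof. by move=> cf cg; exact: cvgM. Qed.

Lemma continuous_add f g x : {for x, continuous f} -> {for x, continuous g} ->
  {for x, continuous (fun y => f y + g y)}.
Proof. by move=> cf cg; exact: cvgD. Qed.

End pointwise_derive.

(** * The energy estimate on a superlevel set and its iteration *)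

Section energy.
Context {R : realType} {n : nat}.
Variables (D : set 'rV[R]_n) (r : R).
Hypotheses (oD : open D) (Dr : forall x, D x -> `|x| <= r).
Variables (a : 'rV[R]_n -> 'M[R]_n) (b : 'rV[R]_n -> 'rV[R]_n)
  (Q : 'rV[R]_n -> R) (eps m M : R).
Hypotheses (eps0 : 0 < eps) (m0 : 0 < m).
Hypotheses (a_sym : forall x, D x -> (a x)^T = a x)
  (a_ell : forall x (v : 'I_n -> R), D x ->
     eps * \sum_i v i ^+ 2 <= \sum_i v i * \sum_j a x i j * v j)
  (a_C1 : forall i j, is_Ck 1 D (fun x => a x i j))
  (Q_C1 : is_Ck 1 D Q)
  (bQ : forall x i, D x -> b x 0 i = \sum_j a x i j * partial j Q x)
  (Q_bound : forall x, D x -> m <= expR (2 * Q x) <= M).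
Variables (u f : 'rV[R]_n -> R) (U : R).
Hypotheses (u_C2 : is_Ck 2 D u) (cu : {within closure D, continuous u})
  (u0 : forall x, (closure D `\` D) x -> u x = 0)
  (uf : forall x, D x -> elliptic_op a b u x = f x)
  (f_tame : tame (ext0 D (fun x => f x ^+ 2 * expR (2 * Q x))))
  (U0 : 0 < U) (uU : forall x, D x -> u x <= U).

Let F2 := int_rV (ext0 D (fun x => f x ^+ 2 * expR (2 * Q x))).

Section level.
Variables (k : R).
Hypothesis (k0 : 0 < k).

(** [V] is the flux [a grad u], and [E] below is the density of [mu_rev]. *)
Let V i x := \sum_j a x i j * partial j u x.
Let p x := Num.max (u x - k) 0.
Let E x := expR (2 * Q x).

Let cuD x : D x -> {for x, continuous u}.
Proof. by case: u_C2 => h _; exact: h. Qed.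

Let du x i : D x -> is_derive x (delta_mx 0 i) u (partial i u x).
Proof. by move=> Dx; apply/derivableP; case: u_C2 => _ /(_ i)[+ _]; exact. Qed.

Let cdu x i : D x -> {for x, continuous (partial i u)}.
Proof. by move=> Dx; case: u_C2 => _ /(_ i)[_ [+ _]]; exact. Qed.

Let ddu x i j : D x ->
  is_derive x (delta_mx 0 i) (partial j u) (partial i (partial j u) x).
Proof.
by move=> Dx; apply/derivableP; case: u_C2 => _ /(_ j)[_ [_ /(_ i)[+ _]]]; exact.
Qed.

Let cddu x i j : D x -> {for x, continuous (partial i (partial j u))}.
Proof. by move=> Dx; case: u_C2 => _ /(_ j)[_ [_ /(_ i)[_ [+ _]]]]; exact. Qed.

Let ca x i j : D x -> {for x, continuous (fun x => a x i j)}.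
Proof. by move=> Dx; case: (a_C1 i j) => + _; exact. Qed.

Let da x i j l : D x ->
  is_derive x (delta_mx 0 l) (fun x => a x i j) (partial l (fun x => a x i j) x).
Proof. by move=> Dx; apply/derivableP; case: (a_C1 i j) => _ /(_ l)[+ _]; exact. Qed.

Let cda x i j l : D x -> {for x, continuous (partial l (fun x => a x i j))}.
Proof. by move=> Dx; case: (a_C1 i j) => _ /(_ l)[_ [+ _]]; exact. Qed.

Let cQ x : D x -> {for x, continuous Q}.
Proof. by case: Q_C1 => h _; exact: h. Qed.

Let dQ x i : D x -> is_derive x (delta_mx 0 i) Q (partial i Q x).
Proof. by move=> Dx; apply/derivableP; case: Q_C1 => _ /(_ i)[+ _]; exact. Qed.

Let cdQ x i : D x -> {for x, continuous (partial i Q)}.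
Proof. by move=> Dx; case: Q_C1 => _ /(_ i)[_ [+ _]]; exact. Qed.

Let cE x : D x -> {for x, continuous E}.
Proof.
move=> Dx; apply: (@continuous_comp _ _ _ (fun y => 2 * Q y) expR).
  by apply: continuous_mul; [exact: continuous_const|exact: cQ].
exact: continuous_expR.
Qed.

Let dE x i : D x -> is_derive x (delta_mx 0 i) E (2 * partial i Q x * E x).
Proof.
move=> Dx; apply: (is_derive_comp (f := fun y => 2 * Q y)).
have h2 : is_derive x (delta_mx 0 i) (fun=> 2 : R) 0 by exact: is_derive_cst.
by have := is_derive_mul h2 (dQ i Dx); rewrite mul0r add0r.
Qed.

Let cp x : D x -> {for x, continuous p}.
Proof.
move=> Dx; apply: (@continuous_comp _ _ _ u (fun t => Num.max (t - k) 0)).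
  exact: cuD.
exact: continuous_maxr.
Qed.

Let dp2 x i : D x ->
  is_derive x (delta_mx 0 i) (fun y => p y ^+ 2) (partial i u x * (2 * p x)).
Proof.
move=> Dx; exact: (is_derive_comp (du i Dx) (is_derive_maxr_sqr k (u x))).
Qed.

Let cV x i : D x -> {for x, continuous (V i)}.
Proof.
move=> Dx; apply: continuous_fsum => j.
by apply: continuous_mul; [exact: ca|exact: cdu].
Qed.

Let dV' x i : D x -> is_derive x (delta_mx 0 i) (V i)
  (\sum_j (partial i (fun x => a x i j) x * partial j u x + a x i j * partial i (partial j u) x)).
Proof.
move=> Dx; apply: is_derive_fsum => j.
by apply: is_derive_mul; [exact: da|exact: ddu].
Qed.

Let dV x i : D x -> is_derive x (delta_mx 0 i) (V i) (partial i (V i) x).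
Proof. by move=> /(dV' i)[h _]; exact/derivableP. Qed.

Let near_D x : D x -> \forall y \near x, D y.
Proof. by move=> Dx; exact: (open_nbhs_nbhs (conj oD Dx)). Qed.

Let cdV x i : D x -> {for x, continuous (partial i (V i))}.
Proof.
move=> Dx; have E1 y : D y -> partial i (V i) y =
    \sum_j (partial i (fun x => a x i j) y * partial j u y + a y i j * partial i (partial j u) y).
  by move=> Dy; rewrite /partial (derive_val (is_derive := dV' i Dy)).
rewrite /prop_for /continuous_at E1//; apply: near_eq_cvg_to.
  apply: filterS (near_D Dx) => y; exact: E1.
apply: continuous_fsum => j; apply: continuous_add.
  by apply: continuous_mul; [exact: cda|exact: cdu].
by apply: continuous_mul; [exact: ca|exact: cddu].
Qed.

Let w := ext0 D (fun x => p x ^+ 2).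
(** The vector field [w exp(2Q) a grad u]; that its divergence has integral 0 is the weak form of
    the equation with test function [w]. *)
Let X i := ext0 D (fun x => p x ^+ 2 * E x * V i x).

Let p_lt y : D y -> u y < k -> p y = 0.
Proof. by move=> _ uy; rewrite /p max_r// subr_le0 ltW. Qed.

Let C1w i : C1c (delta_mx 0 i) w /\
  partial i w = ext0 D (fun x => partial i u x * (2 * p x)).
Proof.
apply: (C1c_ext0 oD Dr k0 cu cuD u0).
- by move=> y Dy uy; rewrite p_lt// expr0n.
- by move=> x Dx; apply: continuous_mul; exact: cp.
- by move=> x Dx; exact: dp2.
- move=> x Dx; apply: continuous_mul; first exact: cdu.
  by apply: continuous_mul; [exact: continuous_const|exact: cp].
Qed.

Let dX i x := (partial i u x * (2 * p x) * E x + p x ^+ 2 * (2 * partial i Q x * E x)) * V i x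
  + p x ^+ 2 * E x * partial i (V i) x.

Let C1X i : C1c (delta_mx 0 i) (X i) /\ partial i (X i) = ext0 D (dX i).
Proof.
have cp2 x : D x -> {for x, continuous (fun y => p y ^+ 2)}.
  by move=> Dx; apply: continuous_mul; exact: cp.
apply: (C1c_ext0 oD Dr k0 cu cuD u0).
- by move=> y Dy uy; rewrite p_lt// expr0n !mul0r.
- move=> x Dx; apply: continuous_mul; last exact: cV.
  by apply: continuous_mul; [exact: cp2|exact: cE].
- move=> x Dx; apply: is_derive_mul; last exact: dV.
  by apply: is_derive_mul; [exact: dp2|exact: dE].
- move=> x Dx; rewrite /dX; apply: continuous_add.
    apply: continuous_mul; last exact: cV.
    apply: continuous_add.
      apply: continuous_mul; last exact: cE.
      apply: continuous_mul; first exact: cdu.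
      by apply: continuous_mul; [exact: continuous_const|exact: cp].
    apply: continuous_mul; first exact: cp2.
    apply: continuous_mul; last exact: cE.
    by apply: continuous_mul; [exact: continuous_const|exact: cdQ].
  apply: continuous_mul; last exact: cdV.
  by apply: continuous_mul; [exact: cp2|exact: cE].
Qed.

(** The weight absorbs the drift: since [b = a grad Q] and [a] is symmetric, [div (E V) = 2 E L u].
    The other term is [E grad w . V] with [grad w = 2 p grad u]. *)
Let divX x : \sum_i partial i (X i) x =
  ext0 D (fun x => 2 * p x * E x * \sum_i partial i u x * V i x +
                   2 * p x ^+ 2 * E x * f x) x.
Proof.
under eq_bigr => i _ do rewrite (C1X i).2.
have [Dx|Dx] := pselect (D x); last first.
  by rewrite ext0_notin// big1// => i _; rewrite ext0_notin.
rewrite ext0_in//; under eq_bigr => i _ do rewrite ext0_in//.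
rewrite -uf// /elliptic_op.
have -> : \sum_i b x 0 i * partial i u x = \sum_i partial i Q x * V i x.
  under eq_bigr => i _ do rewrite bQ// mulr_suml.
  rewrite exchange_big; apply: eq_bigr => j _ /=; rewrite mulr_sumr.
  apply: eq_bigr => i _; rewrite -{1}(a_sym Dx) mxE; ring.
rewrite mulrDr mulrCA !mulr_sumr -!big_split /=.
apply: eq_bigr => i _; rewrite /dX.
have -> : (fun y => \sum_j a y i j * partial j u y) = V i by [].
by field.
Qed.

Let G := \sum_(i < n) int_rV (fun x => partial i w x ^+ 2).
Let S := int_rV (fun x => w x ^+ 2).

(** Since [div X] has integral 0, it can be added to the right-hand integrand, and the inequality
    then holds pointwise. The equation controls only [p |grad u|^2], whereas
    [|grad w|^2 = 4 p^2 |grad u|^2]; the extra factor [p] is bounded by [U]. *)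
Let grad_le (tau : R) : 0 < tau ->
  G <= (2 * U / (eps * m)) * (tau * S + M / tau * F2).
Proof.
move=> t0; have tdw i : tame (fun x => partial i w x ^+ 2).
  exact/tameX2/(C1c_tameD (C1w i).1).
have tdX i : tame (partial i (X i)) by exact: C1c_tameD (C1X i).1.
have tw : tame w.
  apply: (tame_ext0 oD Dr k0 cu u0).
    by move=> y Dy uy; rewrite p_lt// expr0n.
  by move=> x Dx; apply: continuous_mul; exact: cp.
have tw2 := tameX2 tw.
rewrite /G -int_rV_sum//.
have tdiv : tame (fun x => \sum_i partial i (X i) x) by exact: tame_sum.
have div0 : int_rV (fun x => \sum_i partial i (X i) x) = 0.
  by rewrite int_rV_sum// big1// => i _; exact: C1c_integral_derive (C1X i).1.
have -> : tau * S + M / tau * F2 = int_rV (fun x => \sum_i partial i (X i) x +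
    (tau * w x ^+ 2 + M / tau * ext0 D (fun x => f x ^+ 2 * expR (2 * Q x)) x)).
  rewrite int_rVD//; last by apply: tameD; exact: tameZ.
  by rewrite div0 add0r int_rVD ?int_rVZ//; exact: tameZ.
rewrite -int_rVZ; last by apply: tameD => //; apply: tameD; exact: tameZ.
apply: int_rV_le; first exact: tame_sum.
  by apply/tameZ/tameD => //; apply: tameD; exact: tameZ.
move=> x; rewrite divX; under eq_bigr => i _ do rewrite (C1w i).2.
have [Dx|Dx] := pselect (D x); last first.
  rewrite /w !ext0_notin// big1 => [|i _]; last by rewrite ext0_notin// expr0n.
  by rewrite expr0n /= !mulr0 !addr0 mulr0.
rewrite /w !ext0_in//; under eq_bigr => i _ do rewrite ext0_in//.
have /andP[mE EM] := Q_bound Dx; rewrite -/(E x) in mE EM *.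
have p0 : 0 <= p x by rewrite /p le_max lexx orbT.
have pU : p x <= U.
  rewrite /p ge_max (ltW U0) andbT; apply: le_trans (uU Dx).
  by rewrite gerBl ltW.
set q := \sum_i partial i u x * V i x.
set N := \sum_i partial i u x ^+ 2.
have Nq : eps * N <= q by exact: (a_ell (fun i => partial i u x) Dx).
have N0 : 0 <= N by apply: sumr_ge0 => i _; exact: sqr_ge0.
have -> : \sum_i (partial i u x * (2 * p x)) ^+ 2 = 4 * p x ^+ 2 * N.
  by rewrite mulr_sumr; apply: eq_bigr => i _; ring.
(* AM-GM, as [0 <= (tau p^2 + E f)^2 / tau] and [E <= M]. *)
have young : 0 <= 2 * p x ^+ 2 * E x * f x + (tau * (p x ^+ 2) ^+ 2 +
    M / tau * (f x ^+ 2 * E x)).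
  have : 0 <= (tau * p x ^+ 2 + E x * f x) ^+ 2 / tau by rewrite divr_ge0 ?sqr_ge0// ltW.
  rewrite [X in 0 <= X](_ : _ = 2 * p x ^+ 2 * E x * f x + (tau * (p x ^+ 2) ^+ 2 +
      E x / tau * (f x ^+ 2 * E x))); last by field; rewrite gt_eqF.
  move=> /le_trans; apply; rewrite !lerD2l ler_wpM2r//.
    by rewrite mulr_ge0 ?sqr_ge0// expR_ge0.
  by rewrite ler_pM2r// invr_gt0.
have Eq : m * (eps * N) <= E x * q.
  apply: ler_pM => //; [exact: ltW|by rewrite mulr_ge0// ltW].
have em : 0 < eps * m by exact: mulr_gt0.
rewrite [leRHS]mulrAC ler_pdivlMr// -addrA.
have H1 : p x * (p x * N) <= U * (p x * N) by rewrite ler_wpM2r// mulr_ge0.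
have H2 : p x * (m * (eps * N)) <= p x * (E x * q) by rewrite ler_wpM2l.
have H3 := ler_wpM2l (ltW U0) H2.
have H4 := mulr_ge0 (ltW U0) young.
have H5 := ler_wpM2l (ltW em) H1.
set Y := 2 * p x ^+ 2 * E x * f x + _ in H4 *.
apply: (@le_trans _ _ (4 * (U * (p x * (m * (eps * N)))))).
  rewrite (_ : 4 * p x ^+ 2 * N * _ = 4 * (eps * m * (p x * (p x * N)))); last by ring.
  by rewrite (_ : U * _ = eps * m * (U * (p x * N))); [rewrite ler_pM2l|ring].
apply: (@le_trans _ _ (4 * (U * (p x * (E x * q))))); first by rewrite ler_pM2l.
rewrite (_ : 2 * U * _ = 4 * (U * (p x * (E x * q))) + 2 * (U * Y)); last by ring.
by rewrite lerDl mulr_ge0.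
Qed.

Lemma tame_level : tame w.
Proof.
apply: (tame_ext0 oD Dr k0 cu u0).
  by move=> y Dy uy; rewrite p_lt// expr0n.
by move=> x Dx; apply: continuous_mul; exact: cp.
Qed.

(** Combines [faber_krahn], which bounds [S] by [h ^ 2] times the gradient integral, with [grad_le],
    whose source term acquires a second factor [h ^ 2] from the choice of [tau]. *)
Lemma energy_estimate (h : R) : 0 < h -> (0 < n)%N ->
  4 * int_rV (\1_[set x | D x /\ k < u x] : 'rV[R]_n -> R) <= h ^+ n ->
  int_rV (fun x => ext0 D (fun y => Num.max (u y - k) 0 ^+ 2) x ^+ 2) <=
  4 * (8 * n%:R / (eps * m)) ^+ 2 * M * h ^+ 4 * U ^+ 2 * F2.
Proof.
move=> h0 n0 Ah; rewrite -/S.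
have mA : measurable [set x | D x /\ k < u x].
  apply: open_measurable_rV; rewrite openE => x [Dx kx].
  apply: filterI; first exact: near_D.
  exact: (@cvgr_gt _ _ _ _ _ _ (cuD Dx) _ kx).
have Ar x : [set x | D x /\ k < u x] x -> `|x| <= r by case=> /Dr.
have w0 x : ~ [set x | D x /\ k < u x] x -> w x = 0.
  move=> nA; have [Dx|Dx] := pselect (D x); last by rewrite /w ext0_notin.
  rewrite /w ext0_in// /p max_r ?expr0n// subr_le0 leNgt; apply/negP => ku.
  exact: nA.
have tw := tame_level.
have := faber_krahn (fun i => (C1w i).1) tw mA Ar w0 h0 Ah.
rewrite -/S -/G => FK.
set c := 8 * n%:R / (eps * m).
have em : 0 < eps * m by exact: mulr_gt0.
have c0 : 0 < c by rewrite divr_gt0// mulr_gt0// ltr0n.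
(* This value of [tau] makes the coefficient of [S] on the right equal to [1 / 2], so that this term
   can be absorbed on the left. *)
have t0 : 0 < (2 * c * h ^+ 2 * U)^-1.
  rewrite invr_gt0; apply: mulr_gt0 => //.
  by apply: mulr_gt0; [exact: mulr_gt0|exact: exprn_gt0].
have := grad_le t0; rewrite invrK; set tau := (2 * c * h ^+ 2 * U)^-1 => GT.
have nh : 0 <= n%:R * h ^+ 2 by rewrite mulr_ge0 ?sqr_ge0.
have := ler_wpM2l nh GT.
have E1 : 4 * (n%:R * h ^+ 2 * (2 * U / (eps * m) * (tau * S + M * (2 * c * h ^+ 2 * U) * F2)))
   = S / 2 + 2 * c ^+ 2 * M * h ^+ 4 * U ^+ 2 * F2.
  have alg (N h' U' e M' s F : R) : N != 0 -> h' != 0 -> U' != 0 -> e != 0 ->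
      4 * (N * h' ^+ 2 * (2 * U' / e * ((2 * (8 * N / e) * h' ^+ 2 * U')^-1 * s +
        M' * (2 * (8 * N / e) * h' ^+ 2 * U') * F))) =
      s / 2 + 2 * (8 * N / e) ^+ 2 * M' * h' ^+ 4 * U' ^+ 2 * F.
    by move=> N0 h0' U0' e0; field; rewrite e0 U0' h0' N0.
  by apply: (alg n%:R h U (eps * m) M S F2); rewrite gt_eqF// ltr0n.
rewrite -(@ler_pM2l _ 4)// E1 => H.
have : S <= S / 2 + 2 * c ^+ 2 * M * h ^+ 4 * U ^+ 2 * F2.
  by apply: le_trans FK _; rewrite -!mulrA in H *.
by set Z := _ * F2; rewrite (_ : 4 * c ^+ 2 * M * h ^+ 4 * U ^+ 2 * F2 = 2 * Z); [lra|rewrite /Z; ring].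
Qed.

End level.

Let open_superlevel k : open [set x | D x /\ k < u x].
Proof.
rewrite openE => x [Dx kx]; apply: filterI; first exact: (open_nbhs_nbhs (conj oD Dx)).
have cuD : {for x, continuous u} by case: u_C2 => + _; exact.
exact: (@cvgr_gt _ _ _ _ _ _ cuD _ kx).
Qed.

(** In the constant, [8 ^ 4] comes from the gaps [U / (8 * 2 ^ j)] between levels, [16 ^ 3] from the
    ratio 16 of successive radii, and the leading 4 from the smallness condition of [faber_krahn].
    The remaining factor is that of [energy_estimate]. *)
Lemma max_sqr_le (h : R) : (0 < n <= 3)%N -> 1 <= h ->
  4 * int_rV (\1_D : 'rV[R]_n -> R) <= h ^+ n ->
  (exists x0, D x0 /\ u x0 = U) ->
  U ^+ 2 <= 4 * 16 ^+ 3 * 8 ^+ 4 * (4 * (8 * n%:R / (eps * m)) ^+ 2 * M * h ^+ 4 * F2).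
Proof.
move=> /andP[n0 n3] h1 Dh [x0 [Dx0 ux0]]; rewrite leNgt; apply/negP.
set B := _ * F2 => UB.
have h0 : 0 < h by apply: lt_le_trans h1.
pose A k := [set x | D x /\ k < u x].
pose kk (j : nat) := U * (2^-1 - (4 * 2 ^+ j)^-1).
(* For radii [h * 2 ^ (- s j)] the step needs [4 s - 4 >= n s], where the 4 subtracted is the loss
   from the gaps; for [n = 3] this means [s >= 4]. *)
pose hh (j : nat) := h / (2 ^+ j) ^+ 4.
have tA k : tame (\1_(A k) : 'rV[R]_n -> R).
  apply: (@tame_indic _ _ _ r); first by apply: open_measurable_rV; exact: open_superlevel.
  by move=> x [/Dr].
have tD : tame (\1_D : 'rV[R]_n -> R).
  by apply: (@tame_indic _ _ _ r) => //; exact: open_measurable_rV.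
have sub_le (A1 A2 : set 'rV[R]_n) : A1 `<=` A2 -> tame (\1_A1 : _ -> R) ->
    tame (\1_A2 : _ -> R) -> int_rV (\1_A1 : _ -> R) <= int_rV (\1_A2 : 'rV[R]_n -> R).
  move=> A12 t1 t2; apply: int_rV_le => // x; rewrite !indicE ler_nat.
  case: (boolP (x \in A1)) => //; rewrite inE => /A12 ?.
  by rewrite mem_set.
(* The energy estimate gains [hh j ^+ 4], a power larger than [n]; this absorbs the loss
   [(2 ^+ j) ^+ 4] caused by the shrinking gaps between the levels. *)
have step j : 4 * int_rV (\1_(A (kk j)) : 'rV[R]_n -> R) <= hh j ^+ n.
  elim: j => [|j IH].
    apply: le_trans (_ : _ <= 4 * int_rV (\1_D : 'rV[R]_n -> R)) _.
      by rewrite ler_pM2l// sub_le// => x [].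
    by rewrite /hh expr0 expr1n divr1.
  have q0 : 0 < (2 : R) ^+ j by exact: exprn_gt0.
  have q1 : 1 <= (2 : R) ^+ j by rewrite exprn_ege1// ler1n.
  set q := 2 ^+ j in q0 q1 *.
  have kj0 : 0 < kk j.
    rewrite /kk mulr_gt0// subr_gt0 ltf_pV2 ?posrE ?mulr_gt0//.
    by apply: (@lt_le_trans _ _ (4 * 1)); [lra|rewrite ler_pM2l].
  have hj0 : 0 < hh j by rewrite divr_gt0// exprn_gt0.
  have EE := energy_estimate kj0 hj0 n0 IH.
  set S := int_rV _ in EE.
  (* Chebyshev's inequality: on the next superlevel set [u - kk j] exceeds the gap, and [S]
     integrates its fourth power. *)
  have cheb : (U / (8 * q)) ^+ 4 * int_rV (\1_(A (kk j.+1)) : 'rV[R]_n -> R) <= S.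
    rewrite -int_rVZ; last exact: tA.
    apply: int_rV_le; first exact/tameZ/tA.
      exact/tameX2/tame_level.
    move=> x; rewrite indicE; case: (boolP (x \in A (kk j.+1))) => [|_]; last first.
      by rewrite mulr0 sqr_ge0.
    rewrite inE => -[Dx kx]; rewrite mulr1 ext0_in// -exprM.
    have d0 : 0 <= U / (8 * q) by rewrite divr_ge0 ?mulr_ge0// ltW.
    have dE : kk j.+1 = kk j + U / (8 * q).
      rewrite /kk exprS -/q; field; exact: lt0r_neq0.
    have dx : U / (8 * q) <= u x - kk j by rewrite lerBrDl -dE ltW.
    rewrite max_l; last exact: le_trans dx.
    by apply: lerXn2r => //; rewrite nnegrE// (le_trans d0).
  set a1 := int_rV _ in cheb *.
  have a0 : 0 <= a1 by apply: int_rV_ge0 => x; rewrite indicE ler0n.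
  have q4 : 0 < q ^+ 4 by exact: exprn_gt0.
  have := le_trans cheb EE.
  set B0 := 4 * (8 * n%:R / (eps * m)) ^+ 2 * M * h ^+ 4 * F2 in B UB.
  have -> : 4 * (8 * n%:R / (eps * m)) ^+ 2 * M * hh j ^+ 4 * U ^+ 2 * F2 =
      B0 * U ^+ 2 / q ^+ 16.
    rewrite /B0 /hh -/q (expr_div_n h) (_ : (q ^+ 4) ^+ 4 = q ^+ 16); last by rewrite -exprM.
    set z := q ^+ 16; ring.
  have pw : q ^+ 16 = q ^+ 4 * q ^+ 12 by rewrite -exprD.
  have -> : (U / (8 * q)) ^+ 4 * a1 = a1 * q ^+ 12 * U ^+ 2 / 8 ^+ 4 * U ^+ 2 / q ^+ 16.
    rewrite (expr_div_n U) exprMn pw (_ : U ^+ 4 = U ^+ 2 * U ^+ 2); last by rewrite -exprD.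
    have : (8 : R) ^+ 4 != 0 by rewrite gt_eqF// exprn_gt0.
    have : q ^+ 12 != 0 by rewrite gt_eqF// exprn_gt0.
    move: (lt0r_neq0 q4); move: (q ^+ 4) (q ^+ 12) (8 ^+ 4) (U ^+ 2) => x y z t x_0 y_0 z_0.
    by field; rewrite ?x_0 ?y_0 ?z_0.
  rewrite ler_pM2r ?invr_gt0 ?exprn_gt0// ler_pM2r ?exprn_gt0//.
  rewrite ler_pdivrMr; last by rewrite exprn_gt0.
  move=> H.
  have H2 : 4 * a1 * q ^+ 12 * 16 ^+ 3 <= 1.
    rewrite -(@ler_pM2r _ (U ^+ 2)) ?exprn_gt0// mul1r.
    apply: le_trans (ltW UB); rewrite /B.
    have c16 : 0 < 4 * (16 : R) ^+ 3 by rewrite mulr_gt0// exprn_gt0.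
    have := ler_wpM2l (ltW c16) H.
    move: (q ^+ 12) (8 ^+ 4) (16 ^+ 3) (U ^+ 2) => y z v t.
    rewrite -[_ * z * B0]mulrA [z * B0]mulrC; apply: le_trans.
    by rewrite le_eqVlt; apply/orP; left; apply/eqP; ring.
  have hhE : hh j.+1 = h / (16 * q ^+ 4).
    by rewrite /hh (exprS 2 j) -/q exprMn; congr (_ / (_ * _)); rewrite -natrX.
  have q41 : 1 <= 16 * q ^+ 4.
    by apply: (@le_trans _ _ (16 * 1)); [lra|rewrite ler_pM2l// exprn_ege1].
  have q40 : 0 < 16 * q ^+ 4 by apply: lt_le_trans q41.
  (* The bound is obtained with exponent 3; the base is at most 1, so the exponent can be lowered to
     [n], and [1 <= h] inserts the factor [h]. *)
  rewrite hhE; apply: (@le_trans _ _ ((16 * q ^+ 4)^-1 ^+ 3)).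
    rewrite exprVn -[leRHS]mul1r ler_pdivlMr ?exprn_gt0//.
    by rewrite exprMn -exprM [16 ^+ 3 * _]mulrC mulrA.
  apply: (@le_trans _ _ ((16 * q ^+ 4)^-1 ^+ n)).
    by apply: ler_wiXn2l => //; rewrite ?invr_ge0 ?invf_le1// ltW.
  apply: lerXn2r; rewrite ?nnegrE ?invr_ge0 ?divr_ge0 ?(ltW q40) ?(ltW h0)//.
  by rewrite ler_peMl// invr_ge0 ltW.
have pos : 0 < int_rV (\1_(A (U / 2)) : 'rV[R]_n -> R).
  rewrite -lte_fin (@int_rV_indic _ _ _ r).
  - apply: lebesgue_rV_open_gt0; first exact: open_superlevel.
    by exists x0; split=> //; rewrite ux0 ltr_pdivrMr// ltr_pMr// ltr1n.
  - apply: open_measurable_rV; exact: open_superlevel.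
  - by move=> x [/Dr].
set c := int_rV _ in pos.
(* The measures decay much faster, but a factor [2 ^ j] is enough to contradict [0 < c]. *)
have cj j : c * 2 ^+ j <= h ^+ n.
  have q0 : 0 < (2 : R) ^+ j by exact: exprn_gt0.
  have q1 : 1 <= (2 : R) ^+ j by rewrite exprn_ege1// ler1n.
  have sub : A (U / 2) `<=` A (kk j).
    move=> x [Dx ux]; split=> //; apply: le_lt_trans ux.
    by rewrite /kk ler_pM2l// gerBl invr_ge0 mulr_ge0// ltW.
  have := sub_le _ _ sub (tA (U / 2)) (tA (kk j)); rewrite -/c => cI.
  have : 4 * c <= hh j ^+ n by apply: le_trans (step j); rewrite ler_pM2l.
  rewrite /hh expr_div_n -!exprM ler_pdivlMr ?exprn_gt0// => H.
  apply: le_trans H; rewrite -mulrA [c * _ in leRHS]mulrC mulrA [leLHS]mulrC ler_pM2r//.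
  rewrite -[leLHS]mul1r ler_pM// ?(ltW q0)//; first by rewrite ler1n.
  by apply: ler_weXn2l; rewrite ?ler1n// -?mulnA leq_pmulr// muln_gt0.
have [N hN] : exists N, h ^+ n / c < N%:R.
  by exists (Num.truncn (h ^+ n / c)).+1; rewrite truncnS_gt.
have := cj N; rewrite leNgt => /negP; apply.
rewrite mulrC -ltr_pdivrMr//; apply: lt_trans hN _.
by rewrite -natrX ltr_nat ltn_expl.
Qed.

End energy.

(** * Boundedness of [Q] *)

Section real_induction.
Context {R : realType}.

(** Let [t] be the supremum of the points satisfying [P]. Points just to the left of [t] transmit
    [P] to [t], and [t] transmits it to the right, so [t] cannot be smaller than [T]. *)
Lemma real_induction (P : R -> Prop) (T : R) : 0 <= T -> P 0 ->
  (forall t, 0 <= t <= T -> exists2 e, 0 < e & forall s, 0 <= s <= T ->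
     `|s - t| < e -> (s <= t -> P s -> P t) /\ (t <= s -> P t -> P s)) ->
  P T.
Proof.
move=> T0 P0 step.
pose S := [set t | 0 <= t <= T /\ P t].
have S0 : S 0 by split; rewrite ?lexx.
have hS : has_sup S by split; [exists 0|exists T => t [/andP[]]].
have tT : sup S <= T by apply: ge_sup => [|t [/andP[]]//]; exists 0.
have t0 : 0 <= sup S by apply: ub_le_sup => //; case: hS.
have tin : 0 <= sup S <= T by rewrite t0.
have [e e0 H] := step _ tin.
have Pt : P (sup S).
  have [s [sT Ps] st] := sup_adherent e0 hS.
  have sle : s <= sup S by apply: ub_le_sup => //; case: hS.
  apply: (H s sT _).1 => //.
  by rewrite distrC ger0_norm ?subr_ge0// ltrBlDl -ltrBlDr.
have [->//|tlt] := eqVneq T (sup S).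
have {}tlt : sup S < T by rewrite lt_neqAle eq_sym tlt.
pose s := Num.min T (sup S + e / 2).
have se : sup S < s by rewrite lt_min tlt ltrDl divr_gt0.
have sT : 0 <= s <= T by rewrite (le_trans t0 (ltW se)) ge_min lexx.
have : s <= sup S.
  apply: ub_le_sup; first by case: hS.
  split=> //; apply: (H s sT _).2 => //; last exact: ltW.
  rewrite ger0_norm ?subr_ge0 ?ltW// ltrBlDl gt_min; apply/orP; right.
  by rewrite ltrD2l ltr_pdivrMr// ltr_pMr// ltr1n.
by rewrite leNgt se.
Qed.

(** Takes the place of integrating a derivative when [g] is a function along a path that is merely
    Lipschitz. *)
Lemma local_lipschitz_le (g : R -> R) (C : R) :
  (forall t, 0 <= t <= 1 -> exists2 e, 0 < e & forall s, 0 <= s <= 1 ->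
     `|s - t| < e -> `|g s - g t| <= C * `|s - t|) ->
  `|g 1 - g 0| <= C.
Proof.
move=> H; rewrite -[leRHS]mulr1.
apply: (@real_induction (fun t => `|g t - g 0| <= C * t) 1) => //.
  by rewrite subrr normr0 mulr0.
move=> t tT; have [e e0 He] := H t tT; exists e => // s sT ste.
have {}He := He s sT ste; split=> st Hs.
  rewrite -(subrKA (g s)); apply: le_trans (ler_normD _ _) _.
  rewrite distrC; apply: le_trans (lerD He Hs) _.
  by rewrite distrC ger0_norm ?subr_ge0// -mulrDr subrK.
rewrite -(subrKA (g t)); apply: le_trans (ler_normD _ _) _.
apply: le_trans (lerD He Hs) _.
by rewrite ger0_norm ?subr_ge0// -mulrDr subrK.
Qed.

End real_induction.

Lemma norm_segment_lt (R : realType) (V : normedModType R) (c x y : V) (t rho : R) :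
  `|c - x| < rho -> `|c - y| < rho -> 0 <= t <= 1 ->
  `|c - (x + t *: (y - x))| < rho.
Proof.
move=> cx cy /andP[t0 t1].
have -> : c - (x + t *: (y - x)) = (1 - t) *: (c - x) + t *: (c - y).
  have -> : t *: (y - x) = t *: (c - x) - t *: (c - y).
    by rewrite -scalerBr opprB [c - x + _]addrC subrKA.
  by rewrite scalerBl scale1r opprD opprB addrA [t *: (c - y) - _]addrC addrA.
apply: le_lt_trans (ler_normD _ _) _; rewrite !normrZ (ger0_norm t0).
rewrite ger0_norm ?subr_ge0//; move: t0; rewrite le_eqVlt => /predU1P[<-|t0].
  by rewrite mul0r addr0 subr0 mul1r.
apply: (@lt_le_trans _ _ ((1 - t) * rho + t * rho)); last by rewrite -mulrDl subrK mul1r.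
by apply: ler_ltD; [rewrite ler_wpM2l ?subr_ge0// ltW|rewrite ltr_pM2l].
Qed.

Section ball_lipschitz.
Context {R : realType} {n : nat}.
Implicit Types (x y z c : 'rV[R]_n).

(** Balls of the sup norm are boxes: every point on an edge of the staircase has each coordinate
    between those of [x] and [y], so the staircase stays in the ball. *)
Lemma ball_lipschitz (f : 'rV[R]_n -> R) c (rho K : R) : 0 < rho ->
  (forall x i, ball c rho x -> derivable f x (delta_mx 0 i)) ->
  (forall x i, ball c rho x -> `|partial i f x| <= K) ->
  forall x y, ball c rho x -> ball c rho y ->
  `|f y - f x| <= n%:R * K * `|y - x|.
Proof.
move=> rho0 df Kf x y bx bY.
pose z := y - x.
have -> : y = x + z by rewrite /z addrC subrK.
rewrite staircase_telescope addrAC subrr add0r.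
apply: le_trans (ler_norm_sum _ _ _) _.
rewrite -mulrA mulr_natl -[X in _ *+ X]card_ord -sumr_const.
apply: ler_sum => i _.
have st s : 0 <= s <= 1 -> ball c rho (staircase x z i + s *: (z 0 i *: delta_mx 0 i)).
  move=> /andP[s0 s1]; apply/ball_rVP => // j.
  have [l l01 ->] : exists2 l : R, 0 <= l <= 1 &
      (staircase x z i + s *: (z 0 i *: delta_mx 0 i)) 0 j = x 0 j + l * (y 0 j - x 0 j).
    rewrite !mxE eqxx /=; have [ji|ij|ji] := ltngtP j i.
    - exists 1; rewrite ?lexx ?ler01// (_ : (j == i) = false) ?mulr0 ?addr0 ?mul1r//.
      by apply/eqP => E; rewrite E ltnn in ji.
    - exists 0; rewrite ?lexx ?ler01// (_ : (j == i) = false) ?mulr0 ?addr0 ?mul0r ?addr0//.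
      by apply/eqP => E; rewrite E ltnn in ij.
    - exists s; first by rewrite s0 s1.
      have -> : j = i by apply/val_inj.
      by rewrite eqxx mulr1 addr0.
  have hx := (ball_rVP c x rho0).1 bx j.
  have hy := (ball_rVP c y rho0).1 bY j.
  exact: (@norm_segment_lt _ R _ _ _ _ _ hx hy).
have d s : 0 <= s <= 1 -> is_derive (staircase x z i + s *: (z 0 i *: delta_mx 0 i))
    (z 0 i *: delta_mx 0 i) f
    (z 0 i * partial i f (staircase x z i + s *: (z 0 i *: delta_mx 0 i))).
  by move=> s01; apply: is_derive_dirZ; apply/derivableP; apply: df; exact: st.
have := @MVT_norm _ _ f (staircase x z i) (z 0 i *: delta_mx 0 i) 1 (K * `|z|).
rewrite scale1r mulr1; apply=> // s s01.
  by case: (d s s01).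
rewrite (derive_val (is_derive := d s s01)) normrM mulrC ler_pM//.
  by apply: Kf; exact: st.
exact: rV_coord_norm.
Qed.

End ball_lipschitz.

Lemma closure_norm_le (R : realType) n (D : set 'rV[R]_n) : bounded_set D ->
  exists r, forall x, closure D x -> `|x| <= r.
Proof.
move=> [M [_ HM]]; exists (M + 1) => x.
have cB := @closed_norm_le R n (M + 1).
have /closure_subset : D `<=` [set x : 'rV[R]_n | `|x| <= M + 1].
  by move=> y Dy; apply: HM => //; rewrite ltrDl.
by rewrite -((closure_id _).1 cB); exact.
Qed.

Lemma compact_closure_rV (R : realType) n (D : set 'rV[R]_n) : bounded_set D ->
  compact (closure D).
Proof.
move=> /closure_norm_le[r Dr]; apply: bounded_closed_compact; last exact: closed_closure.
by exists r; split=> [|y ry x /Dr xr]; [exact: num_real|exact: le_trans xr (ltW ry)].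
Qed.

Section lipschitz_connected.
Context {R : realType}.

Definition lipschitz_path n (M : R) (D : set 'rV[R]_n) (g : R -> 'rV[R]_n) :=
  (forall s t, 0 <= s <= 1 -> 0 <= t <= 1 -> `|g s - g t| <= M * `|s - t|) /\
  (forall t, 0 <= t <= 1 -> D (g t)).

(** Required at all points of the closure, so that compactness applies. The constant [M] bounds the
    paths uniformly near [x0]; it need not be proportional to the distance of their endpoints. *)
Definition loc_lipschitz_connected n (D : set 'rV[R]_n) :=
  forall x0, closure D x0 -> exists M (V : set 'rV[R]_n), nbhs x0 V /\
    forall x y, D x -> D y -> V x -> V y ->
    exists g, [/\ lipschitz_path M D g, g 0 = x & g 1 = y].

Lemma lipschitz_path_variation n (D : set 'rV[R]_n) (Q : 'rV[R]_n -> R) (K M : R) g :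
  open D -> (forall x i, D x -> derivable Q x (delta_mx 0 i)) ->
  (forall x i, D x -> `|partial i Q x| <= K) -> 0 <= K ->
  lipschitz_path M D g -> `|Q (g 1) - Q (g 0)| <= n%:R * K * M.
Proof.
move=> oD dQ KQ K0 [gM gD].
apply: (@local_lipschitz_le _ (Q \o g)) => t t01.
have M0 : 0 <= M.
  have := gM 0 1; rewrite !lexx !ler01 => /(_ isT isT).
  by rewrite sub0r normrN1 mulr1; apply: le_trans.
have [e /= e0 eD] : nbhs_ball (g t) D by apply/nbhs_ballP; apply: open_nbhs_nbhs; split=> //; exact: gD.
exists (e / (M + 1)); first by rewrite divr_gt0// ltr_wpDl.
move=> s s01 st.
have gst : `|g s - g t| < e.
  apply: le_lt_trans (gM _ _ s01 t01) _.
  apply: (@le_lt_trans _ _ ((M + 1) * `|s - t|)).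
    by rewrite ler_wpM2r// lerDl.
  by rewrite mulrC -ltr_pdivlMr// ltr_wpDl.
apply: (@le_trans _ _ (n%:R * K * `|g s - g t|)).
  apply: (ball_lipschitz (c := g t) (rho := e)) => //.
  - by move=> x i /eD; exact: dQ.
  - by move=> x i /eD; exact: KQ.
  - exact: ballxx.
  - by rewrite -ball_normE /= distrC.
by rewrite -[leRHS]mulrA ler_wpM2l ?mulr_ge0// gM.
Qed.

(** Near a point of the closure, [Q] differs by a bounded amount from its value at one fixed nearby
    point of [D]; compactness of the closure makes the resulting bounds uniform. *)
Lemma loc_lipschitz_bounded n (D : set 'rV[R]_n) (Q : 'rV[R]_n -> R) (K : R) :
  open D -> bounded_set D -> loc_lipschitz_connected D ->
  (forall x i, D x -> derivable Q x (delta_mx 0 i)) ->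
  (forall x i, D x -> `|partial i Q x| <= K) -> 0 <= K ->
  exists C, forall x, D x -> `|Q x| <= C.
Proof.
move=> oD bD lD dQ KQ K0.
have cD := compact_closure_rV bD.
move/compact_near_coveringP : cD => /(_ R (pinfty_nbhs R) (fun M x => D x -> `|Q x| <= M)) H.
have [x0 cx0|C [_ HC]] := H _.
  have [M [V [Vx0 HV]]] := lD x0 cx0.
  have [y [Dy Vy]] := cx0 _ Vx0.
  exists (V, [set C | `|Q y| + n%:R * K * M <= C]) => /=.
    split=> //; exists (`|Q y| + n%:R * K * M); split; first exact: num_real.
    by move=> C /ltW.
  move=> [x C] /= [Vx CC] Dx; apply: le_trans CC.
  have [g [pg g0 g1]] := HV _ _ Dy Dx Vy Vx.
  have := lipschitz_path_variation oD dQ KQ K0 pg; rewrite g0 g1 => h.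
  rewrite -(subrK (Q y) (Q x)) addrC; apply: le_trans (ler_normD _ _) _.
  by rewrite lerD2l.
exists (C + 1) => x Dx; apply: HC => //; first by rewrite ltrDl.
exact: subset_closure.
Qed.

(** Inside [D] a segment in a ball does. At a boundary point, the images of two points of [D] under
    the chart lie in the intersection of a ball with an open half-space, which is convex; the path
    is the image under [chi] of the segment between them. *)
Lemma Ckalpha_boundary_lipschitz n (alpha : R) (D : set 'rV[R]_n) :
  open D -> Ckalpha_boundary 2 alpha D -> loc_lipschitz_connected D.
Proof.
move=> oD bD x0 cx0; have [Dx0|Dx0] := pselect (D x0).
  have [e /= e0 eD] : nbhs_ball x0 D by apply/nbhs_ballP; exact: open_nbhs_nbhs.
  exists (e + e), (ball x0 e); split; first exact: nbhsx_ballx.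
  move=> x y Dx Dy; rewrite -!ball_normE /= => bx bY.
  have xy : `|y - x| <= e + e.
    rewrite -(subrKA x0); apply: le_trans (ler_normD _ _) _.
    by rewrite lerD// ?[`|y - _|]distrC ltW.
  exists (fun t => x + t *: (y - x)); split; last first.
  - by rewrite scale1r addrC subrK.
  - by rewrite scale0r addr0.
  split=> [s t _ _|t t01].
    rewrite opprD addrACA subrr add0r -scalerBl normrZ mulrC.
    by rewrite ler_wpM2r.
  by apply: eD; rewrite -ball_normE /=; exact: norm_segment_lt.
have [B [psi [chi [j [[oB Bx0] [opB chipsi] [Cpsi Cchi] Dpos bd0]]]]] := bD x0 (conj cx0 Dx0).
have Cchi1 i : is_Ck 2 (psi @` B) (fun y => chi y 0 i) by case: (Cchi i).
have Cpsi1 i : is_Ck 2 B (fun y => psi y 0 i) by case: (Cpsi i).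
pose y0 := psi x0.
have py0 : (psi @` B) y0 by exists x0.
(* The added 1 leaves room for continuity: [K] bounds every first derivative of [chi] on a whole
   ball around [y0]. *)
pose K := \sum_i \sum_l (`|partial l (fun y => chi y 0 i) y0| + 1).
have [rho /= rho0 Hrho] : exists2 rho, 0 < rho & forall y, ball y0 rho y -> (psi @` B) y /\
   forall i l, `|partial l (fun y => chi y 0 i) y| <= K.
  have : \forall y \near y0, (psi @` B) y /\
      forall i l, `|partial l (fun y => chi y 0 i) y| <= K.
    apply: filterI; first exact: open_nbhs_nbhs.
    apply: (@filter_forall _ _ (fun i y => forall l,
      `|partial l (fun y => chi y 0 i) y| <= K) (nbhs y0) _) => i.
    apply: (@filter_forall _ _ (fun l y =>
      `|partial l (fun y => chi y 0 i) y| <= K) (nbhs y0) _) => l.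
    have cil : {for y0, continuous (partial l (fun y => chi y 0 i))}.
      by case: (Cchi1 i) => _ /(_ l)[_ [+ _]]; exact.
    have lt1 : `|partial l (fun y => chi y 0 i) y0| <
        `|partial l (fun y => chi y 0 i) y0| + 1 by rewrite ltrDl.
    have near1 := @cvgr_lt _ _ _ _ _ _ (cvg_norm cil) _ lt1.
    apply: (@filterS _ (nbhs y0) _ _ _ _ (near1 _ _)) => y /ltW /le_trans; apply.
    rewrite /K (bigD1 i)//= (bigD1 l)//= -addrA lerDl.
    apply: addr_ge0; first by apply: sumr_ge0 => ? _; rewrite addr_ge0.
    by do 2 (apply: sumr_ge0 => ? _); rewrite addr_ge0.
  by move=> /nbhs_ballP[rho /= rho0 Hr]; exists rho.
have [e /= e0 He] : exists2 e, 0 < e & forall x, ball x0 e x -> B x /\ ball y0 rho (psi x).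
  have : \forall x \near x0, B x /\ forall i, `|y0 0 i - psi x 0 i| < rho.
    apply: filterI; first exact: open_nbhs_nbhs.
    apply: (@filter_forall _ _ (fun i x => `|y0 0 i - psi x 0 i| < rho) (nbhs x0) _) => i.
    have ci : {for x0, continuous (fun x => psi x 0 i)} by case: (Cpsi1 i) => + _; exact.
    by move/cvgrPdist_lt : ci; exact.
  move=> /nbhs_ballP[e /= e0 He]; exists e => // x /He[Bx px]; split=> //.
  exact/ball_rVP.
exists (n%:R * K * (rho + rho)), (ball x0 e); split; first exact: nbhsx_ballx.
move=> x y Dx Dy bx bY; have [Bx px] := He x bx; have [By py] := He y bY.
pose sg t := psi x + t *: (psi y - psi x).
have sg_ball t : 0 <= t <= 1 -> ball y0 rho (sg t).
  by move: px py; rewrite -!ball_normE /=; exact: norm_segment_lt.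
have sg_pos t : 0 <= t <= 1 -> 0 < sg t 0 j.
  have := Dpos x Bx Dx; have := Dpos y By Dy; rewrite /sg !mxE.
  move: (psi x 0 j) (psi y 0 j) => p q q0 p0 /andP[t0 t1].
  have := mulr_ge0 t0 (ltW q0); have [->|tn1] := eqVneq t 1; first by lra.
  have : 0 < (1 - t) * p by rewrite mulr_gt0// subr_gt0 lt_neqAle tn1.
  by lra.
have K0 : 0 <= K by apply: sumr_ge0 => i _; apply: sumr_ge0 => l _; rewrite addr_ge0.
have gM s t : 0 <= s <= 1 -> 0 <= t <= 1 ->
    `|chi (sg s) - chi (sg t)| <= n%:R * K * (rho + rho) * `|s - t|.
  move=> s01 t01; apply/rV_norm_leP => [|i].
    by rewrite !mulr_ge0// addr_ge0// ltW.
  rewrite !mxE.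
  apply: le_trans (ball_lipschitz (f := fun y => chi y 0 i) (c := y0) (K := K) rho0 _ _
    (sg_ball t t01) (sg_ball s s01)) _.
  - by move=> z l /Hrho[pz _]; case: (Cchi1 i) => _ /(_ l)[+ _]; exact.
  - by move=> z l /Hrho[_ +]; exact.
  rewrite -!mulrA ler_wpM2l// ler_wpM2l//.
  have -> : sg s - sg t = (s - t) *: (psi y - psi x).
    by rewrite /sg opprD addrACA subrr add0r scalerBl.
  rewrite normrZ mulrC ler_wpM2r//.
  move: px py; rewrite -!ball_normE /= => px py.
  rewrite -(subrKA y0); apply: le_trans (ler_normD _ _) _.
  by rewrite lerD// ?[`|psi y - _|]distrC ltW.
(* In the chart the path is a segment in the open half-space, so it avoids the boundary
   of [D], and it cannot leave [D]. *)
have gbd t : 0 <= t <= 1 -> ~ (closure D `\` D) (chi (sg t)).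
  move=> t01 bdt; have [[b Bb pb] _] := Hrho _ (sg_ball t t01).
  have Bc : B (chi (sg t)) by rewrite -pb chipsi.
  have := bd0 _ Bc bdt; rewrite -pb chipsi// pb => E.
  by have := sg_pos t t01; rewrite E ltxx.
have gD t : 0 <= t <= 1 -> D (chi (sg t)).
  move=> /andP[t0 t1]; apply: (@real_induction _ (fun s => D (chi (sg s))) t) => //.
    by rewrite /sg scale0r addr0 chipsi.
  move=> s /andP[s0 st].
  have s01 : 0 <= s <= 1 by rewrite s0 (le_trans st).
  (* Off the boundary, membership in [D] is locally constant: both [D] and the complement of its
     closure are open. *)
  have [e' /= e'0 He'] : exists2 e', 0 < e' &
      forall z, ball (chi (sg s)) e' z -> (D z <-> D (chi (sg s))).
    have : \forall z \near chi (sg s), D z <-> D (chi (sg s)).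
      have [Ds|Ds] := pselect (D (chi (sg s))).
        by apply: filterS (open_nbhs_nbhs (conj oD Ds)) => z.
      have nD : ~ closure D (chi (sg s)) by move=> cDs; exact: (gbd s s01).
      have : nbhs (chi (sg s)) (~` closure D).
        by apply: open_nbhs_nbhs; split=> //; rewrite openC; exact: closed_closure.
      by apply: filterS => z nz; split=> // Dz; exfalso; apply: nz; exact: subset_closure.
    by move=> /nbhs_ballP[e' /= e'0 He']; exists e'.
  set L := n%:R * K * (rho + rho) in gM.
  have L0 : 0 <= L by rewrite !mulr_ge0// addr_ge0// ltW.
  exists (e' / (L + 1)); first by rewrite divr_gt0// ltr_wpDl.
  move=> s' /andP[s'0 s't] ss'.
  have s'01 : 0 <= s' <= 1 by rewrite s'0 (le_trans s't).
  have [|H1 H2] := He' (chi (sg s')).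
    rewrite -ball_normE /= distrC; apply: le_lt_trans (gM _ _ s'01 s01) _.
    apply: (@le_lt_trans _ _ ((L + 1) * `|s' - s|)).
      by rewrite ler_wpM2r// lerDl.
    by rewrite mulrC -ltr_pdivlMr// ltr_wpDl.
  by split.
exists (chi \o sg); split=> //=.
- by rewrite /sg scale0r addr0 chipsi.
- by rewrite /sg scale1r addrC subrK chipsi.
Qed.

End lipschitz_connected.

(** * Product domains *)

Section product.
Context {R : realType}.

(** The paths in the factors are run simultaneously. In the sup norm the largest of their constants
    would do, and the sum of the [M i] in absolute value dominates it. *)
Lemma product_lipschitz (k : nat) (p : 'I_k -> nat)
    (D_ : forall i, set 'rV[R]_(p i)) :
  (forall i, loc_lipschitz_connected (D_ i)) ->
  loc_lipschitz_connected
    [set x : 'rV[R]_(\sum_i p i) | forall i, D_ i (submxrow x i)].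
Proof.
move=> H x0 cx0; set D := [set x | _].
have block_le i (x y : 'rV[R]_(\sum_i p i)) :
    `|submxrow x i - submxrow y i| <= `|x - y|.
  by apply/rV_norm_leP => // j; rewrite !mxE; have := rV_coord_norm (x - y) (tagnat.Rank i j); rewrite !mxE.
have block_nbhs i (x : 'rV[R]_(\sum_i p i)) (V : set 'rV[R]_(p i)) :
    nbhs (submxrow x i) V -> nbhs x [set y | V (submxrow y i)].
  move=> /nbhs_ballP[e /= e0 eV]; apply/nbhs_ballP; exists e => //= y.
  rewrite -ball_normE /= => xy; apply: eV; rewrite -ball_normE /=.
  exact: le_lt_trans (block_le i x y) xy.
have cl i : closure (D_ i) (submxrow x0 i).
  by move=> W /block_nbhs /cx0[y [yD yW]]; exists (submxrow y i); split=> //; exact: (yD i).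
pose M i := sval (cid (H i _ (cl i))).
pose V i := sval (cid (svalP (cid (H i _ (cl i))))).
have HV i := svalP (cid (svalP (cid (H i _ (cl i))))); rewrite -/(M _) -/(V _) in HV.
exists (\sum_i `|M i|), [set y | forall i, V i (submxrow y i)]; split.
  apply: (@filter_forall _ _ (fun i y => V i (submxrow y i)) (nbhs x0) _) => i.
  exact/block_nbhs/(HV i).1.
move=> x y Dx Dy Vx Vy.
pose g i := sval (cid ((HV i).2 _ _ (Dx i) (Dy i) (Vx i) (Vy i))).
have Hg i := svalP (cid ((HV i).2 _ _ (Dx i) (Dy i) (Vx i) (Vy i))).
exists (fun t => \mxrow_i g i t); split.
- split=> [s t s01 t01|t t01 i]; last first.
    by rewrite mxrowK; have [[_ h] _ _] := Hg i; exact: h.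
  apply/rV_norm_leP => [|l]; first by rewrite mulr_ge0// sumr_ge0.
  rewrite !mxE; have [[h _] _ _] := Hg (tagnat.sig1 l).
  have := rV_coord_norm (g (tagnat.sig1 l) s - g (tagnat.sig1 l) t) (tagnat.sig2 l).
  rewrite !mxE => /le_trans; apply; apply: le_trans (h s t s01 t01) _.
  rewrite ler_wpM2r// (bigD1 (tagnat.sig1 l))//= (le_trans (ler_norm _))// lerDl.
  by rewrite sumr_ge0.
- by rewrite -[RHS]submxrowK; apply/eq_mxrow => i; case: (Hg i).
- by rewrite -[RHS]submxrowK; apply/eq_mxrow => i; case: (Hg i).
Qed.

Lemma standing_assumptions_lipschitz (d : nat) (alpha : R) (D : set 'rV[R]_d)
    (a : 'rV[R]_d -> 'M[R]_d) (b : 'rV[R]_d -> 'rV[R]_d) :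
  standing_assumptions alpha D a b -> loc_lipschitz_connected D.
Proof.
move=> [d0 alpha01 [oD _ _ _] _ [bD|]]; first exact: Ckalpha_boundary_lipschitz bD.
move=> [k [p [e [D_ [a_ [b_ [k0 Hi DE _ _]]]]]]].
(* Eliminating [e] replaces [d] by the sum of the block sizes, after which the casts are
   identities. *)
move: D a b oD DE; case: d / e d0 => d0 D a b oD -> .
rewrite (_ : [set x | _] = [set x | forall i, D_ i (submxrow x i)]); last first.
  by apply/seteqP; split=> x /= h i; have := h i; rewrite castmx_id.
apply: product_lipschitz => i.
have [_ [oDi _ _ _] bDi _] := Hi i.
exact: Ckalpha_boundary_lipschitz bDi.
Qed.

End product.

(** * Uniform ellipticity and the gradient of [Q] *)

Section compactness.
Context {R : realType} {n : nat}.
Variables (D : set 'rV[R]_n) (a : 'rV[R]_n -> 'M[R]_n) (b : 'rV[R]_n -> 'rV[R]_n).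
Hypotheses (bD : bounded_set D) (n0 : (0 < n)%N).
Hypotheses (a_pos : forall x (v : 'rV[R]_n), v != 0 -> 0 < (v *m a x *m v^T) 0 0)
  (ca : forall i j, continuous (fun x => a x i j)).

(** The quadratic form attains a positive minimum on the compact product of the closure of [D] and
    the unit sphere of the sup norm; homogeneity extends the bound to all vectors. *)
Lemma uniform_ellipticity : D !=set0 -> exists2 eps : R, 0 < eps &
  forall x (v : 'I_n -> R), D x ->
    eps * \sum_i v i ^+ 2 <= \sum_i v i * \sum_j a x i j * v j.
Proof.
move=> D0.
pose S := [set v : 'rV[R]_n | `|v| = 1].
have cS : compact S.
  apply: bounded_closed_compact.
    exists 1; split=> [|y y1 x Sx]; first exact: num_real.
    have x1 : `|x| <= 1 by move: Sx; rewrite /S /= => ->.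
    exact: le_trans x1 (ltW y1).
  apply: (@preimage_closed _ _ (Num.norm : 'rV[R]_n -> R) [set y : R | y = 1]).
    by move=> x _; exact: norm_continuous.
  exact: closed_eq.
have S0 : S !=set0.
  exists (const_mx 1); apply/eqP; rewrite eq_le; apply/andP; split.
    by apply/rV_norm_leP => // i; rewrite mxE normr1.
  have := rV_coord_norm (const_mx 1 : 'rV[R]_n) (Ordinal n0).
  by rewrite mxE normr1.
pose q (z : 'rV[R]_n * 'rV[R]_n) := \sum_i z.2 0 i * \sum_j a z.1 i j * z.2 0 j.
have csnd i : continuous (fun z : 'rV[R]_n * 'rV[R]_n => z.2 0 i).
  move=> z; apply: (@continuous_comp _ _ _ snd (fun x : 'rV[R]_n => x 0 i)).
    exact: cvg_snd.
  exact: coord_continuous.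
have cfst i j : continuous (fun z : 'rV[R]_n * 'rV[R]_n => a z.1 i j).
  move=> z; apply: (@continuous_comp _ _ _ fst (fun x : 'rV[R]_n => a x i j)).
    exact: cvg_fst.
  exact: ca.
have cq : continuous q.
  move=> z; apply: (@continuous_fsum R) => i; apply: (@continuous_mul R); first exact: csnd.
  apply: (@continuous_fsum R) => j; apply: (@continuous_mul R); [exact: cfst|exact: csnd].
have qE x v : q (x, v) = (v *m a x *m v^T) 0 0.
  rewrite /q /= [RHS]mxE; under [RHS]eq_bigr => j _ do rewrite !mxE mulr_suml.
  rewrite exchange_big; apply: eq_bigr => i _ /=; rewrite mulr_sumr.
  by apply: eq_bigr => j _; rewrite mulrA.
have [[z1 z2]] : exists2 z, z \in closure D `*` S & forall t, t \in closure D `*` S -> q z <= q t.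
  apply: compact_EVT_min.
  - by case: D0 => x Dx; case: S0 => v Sv; exists (x, v); split=> //; exact: subset_closure.
  - by apply: compact_setX => //; exact: compact_closure_rV.
  - exact: continuous_subspaceT.
rewrite inE => -[_ /= z2S] qz.
have qz0 : 0 < q (z1, z2).
  rewrite qE; apply: a_pos; apply/eqP => z20.
  by move: z2S; rewrite /S /= z20 normr0 => /eqP; rewrite eq_sym oner_eq0.
(* The division by [n] passes from the sup norm to the sum of squares. *)
exists (q (z1, z2) / n%:R); first by rewrite divr_gt0// ltr0n.
move=> x v Dx; pose w := \row_i v i.
have -> : \sum_i v i * \sum_j a x i j * v j = q (x, w).
  by apply: eq_bigr => i _; rewrite !mxE; congr (_ * _); apply: eq_bigr => j _; rewrite mxE.
have vw : \sum_i v i ^+ 2 <= n%:R * `|w| ^+ 2.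
  rewrite mulr_natl -[X in _ *+ X]card_ord -sumr_const; apply: ler_sum => i _.
  have := rV_coord_norm w i; rewrite mxE => h.
  by rewrite -(real_normK (num_real (v i))) ler_sqr ?nnegrE.
apply: (@le_trans _ _ (q (z1, z2) * `|w| ^+ 2)).
  by rewrite -mulrA ler_pM2l// ler_pdivrMl ?ltr0n.
have [->|w0] := eqVneq w 0.
  rewrite normr0 expr0n mulr0 /q big1// => i _; by rewrite mxE mul0r.
have nw : 0 < `|w| by rewrite normr_gt0.
have : q (z1, z2) <= q (x, `|w|^-1 *: w).
  apply: qz; rewrite inE; split=> /=; first exact: subset_closure.
  by rewrite /S /= normrZ normfV normr_id mulVf// gt_eqF.
have -> : q (x, `|w|^-1 *: w) = q (x, w) / `|w| ^+ 2.
  rewrite /q /= mulr_suml; apply: eq_bigr => i _.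
  rewrite -exprVn expr2 mulr_sumr mulr_sumr mulr_suml; apply: eq_bigr => j _.
  by rewrite !mxE; ring.
by rewrite ler_pdivlMr// exprn_gt0.
Qed.

(** Pairing [b = a grad Q] with [grad Q], ellipticity and Young's inequality give
    [|grad Q|^2 <= |b|^2 / eps^2], and [b] is bounded on the compact closure. *)
Lemma gradient_bounded (Q : 'rV[R]_n -> R) : D !=set0 ->
  (forall i, continuous (fun x => b x 0 i)) ->
  (forall x i, D x -> b x 0 i = \sum_j a x i j * partial j Q x) ->
  exists2 K : R, 0 <= K & forall x i, D x -> `|partial i Q x| <= K.
Proof.
move=> D0 cb bQ; have [eps eps0 ell] := uniform_ellipticity D0.
have D0c : closure D !=set0 by case: D0 => x Dx; exists x; exact: subset_closure.
have cB : continuous (fun x => \sum_i b x 0 i ^+ 2).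
  move=> x; apply: (@continuous_fsum R) => i.
  by apply: (@continuous_mul R); exact: cb.
have [c _ hc] := compact_EVT_max D0c (compact_closure_rV bD) (continuous_subspaceT cB).
set B := \sum_i _ in hc; have B0 : 0 <= B by apply: sumr_ge0 => i _; exact: sqr_ge0.
(* A bound on the square gives one on the absolute value by [t <= 1 + t ^ 2], which avoids square
   roots. *)
exists (1 + B / eps ^+ 2) => [|x i Dx]; first by rewrite addr_ge0// divr_ge0// sqr_ge0.
pose v j := partial j Q x.
have bx : \sum_j b x 0 j ^+ 2 <= B by apply: hc; rewrite inE; exact: subset_closure.
have := ell x v Dx.
under [X in _ <= X -> _]eq_bigr => j _ do rewrite -bQ//.
move=> H; have H2 : \sum_j v j * b x 0 j <= eps / 2 * \sum_j v j ^+ 2 + (2 * eps)^-1 * B.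
  apply: (@le_trans _ _ (eps / 2 * \sum_j v j ^+ 2 + (2 * eps)^-1 * \sum_j b x 0 j ^+ 2)).
    rewrite !mulr_sumr -big_split /=; apply: ler_sum => j _.
    rewrite -subr_ge0 (_ : _ - _ = (eps * v j - b x 0 j) ^+ 2 / (2 * eps)); last first.
      by field; rewrite gt_eqF.
    by rewrite divr_ge0 ?sqr_ge0// mulr_ge0// ltW.
  by rewrite lerD2l ler_wpM2l// invr_ge0 mulr_ge0// ltW.
have H3 : \sum_j v j ^+ 2 <= B / eps ^+ 2.
  rewrite ler_pdivlMr ?exprn_gt0//.
  have := le_trans H H2; set s := \sum_j _ => H4.
  have : eps / 2 * s <= (2 * eps)^-1 * B by lra.
  have e2 : 0 < 2 * eps by rewrite mulr_gt0.
  move=> H5; have := ler_wpM2l (ltW e2) H5; rewrite [leRHS]mulrA mulfV ?gt_eqF// mul1r.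
  by rewrite (_ : 2 * eps * _ = s * eps ^+ 2)//; field.
have H4 : v i ^+ 2 <= B / eps ^+ 2.
  apply: le_trans H3; rewrite (bigD1 i)//= lerDl.
  by apply: sumr_ge0 => j _; exact: sqr_ge0.
rewrite -/(v i); have := sqr_ge0 (`|v i| - 1); have := normr_ge0 (v i).
rewrite sqrrB real_normK ?num_real// expr1n mulr1; lra.
Qed.

End compactness.

(** * The eigenfunction expansion *)

Section convergence.
Context {R : realType} {d : nat}.
Variables (D : set 'rV[R]_d) (F : nat -> R) (psi : nat -> 'rV[R]_d -> R) (B C : R).
Hypotheses (FB : forall N, \sum_(n < N) F n ^+ 2 <= B)
  (psiC : forall N x, D x -> \sum_(n < N) psi n x ^+ 2 <= C).

Let s (N : nat) := series (fun n => F n ^+ 2) N.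

Let nds : nondecreasing_seq s.
Proof.
apply/nondecreasing_seqP => N; rewrite /s /series /= big_nat_recr//= lerDl.
exact: sqr_ge0.
Qed.

Let cs : cvgn s.
Proof.
apply: nondecreasing_is_cvgn => //; exists B => _ [N _ <-].
by rewrite /s /series /= big_mkord.
Qed.

Let tail (M N : nat) x : (M <= N)%N -> D x ->
  (\sum_(M <= n < N) `|F n * psi n x|) ^+ 2 <= C * (s N - s M).
Proof.
move=> MN Dx; under eq_bigr do rewrite normrM.
apply: le_trans (sum_CauchySchwarz _ _ _) _.
under eq_bigr do rewrite real_normK ?num_real//.
under [X in _ * X <= _]eq_bigr do rewrite real_normK ?num_real//.
rewrite mulrC; apply: ler_pM; [by apply: sumr_ge0 => *; exact: sqr_ge0..| |].
  apply: le_trans (psiC N Dx); rewrite -(big_mkord xpredT (fun n => psi n x ^+ 2)).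
  rewrite [leRHS](big_cat_nat _ (n := M))//= lerDr.
  by apply: sumr_ge0 => *; exact: sqr_ge0.
by rewrite /s sub_series_geq.
Qed.

Lemma square_summable_cvg :
  converges_uniformly_absolutely D (fun n x => F n * psi n x).
Proof.
have abs x : D x -> cvgn (series (fun n => `|F n * psi n x|)).
  move=> Dx; apply: nondecreasing_is_cvgn.
    by apply/nondecreasing_seqP => N; rewrite /series /= big_nat_recr//= lerDl.
  (* [tail] bounds the square of a partial sum by [C * B], and [y <= 1 + y ^ 2]. *)
  exists (1 + C * B) => _ [N _ <-].
  have C0 : 0 <= C by have := psiC 0 Dx; rewrite big_ord0.
  have s0 : 0 <= s 0 by rewrite /s /series /=; apply: sumr_ge0 => *; exact: sqr_ge0.
  have sB : s N - s 0 <= B by rewrite lerBlDr; apply: ler_wpDr => //; rewrite /s /series /= big_mkord.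
  have := le_trans (tail (leq0n N) Dx) (ler_wpM2l C0 sB).
  rewrite -/(series _ N) => H; apply: le_trans (lerD (lexx 1) H).
  rewrite /series /=; set y := \sum_(0 <= _ < N) _.
  by have := sqr_ge0 (y - 1); have := sqr_ge0 y; rewrite sqrrB; lra.
split; last exact: abs.
pose S N x := \sum_(n < N) F n * psi n x.
have SE N x : S N x = series (fun n => F n * psi n x) N by rewrite /S /series /= big_mkord.
have cS x : D x -> cvgn (fun N => S N x).
  move=> Dx; have := normed_cvg (abs x Dx).
  by rewrite (_ : series _ = (fun N => S N x))//; apply/funext => N; rewrite SE.
exists (fun x => limn (fun N => S N x)).
(* The sign of [C] is unknown if [D] is empty; [K] can be divided by in every case. *)
pose K := `|C| + 1; have K0 : 0 < K by rewrite ltr_wpDl.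
have sG N : s N <= limn s by exact: nondecreasing_cvgn_le.
have bound N x : D x -> `|limn (fun N => S N x) - S N x| <= Num.sqrt (K * (limn s - s N)).
  move=> Dx; have cN : `|S N' x - S N x| @[N' --> \oo] --> `|limn (fun N => S N x) - S N x|.
    by apply: cvg_norm; apply: cvgB; [exact: cS|exact: cvg_cst].
  rewrite -(cvg_lim _ cN)//; apply: limr_le; first by apply/cvg_ex; eexists; exact: cN.
  exists N => // N' /= NN'; rewrite !SE sub_series_geq//.
  apply: le_trans (ler_norm_sum _ _ _) _.
  rewrite -[leLHS]ger0_norm ?sumr_ge0// -sqrtr_sqr ler_sqrt; last first.
    by rewrite mulr_ge0 ?subr_ge0// ltW.
  apply: le_trans (tail NN' Dx) _.
  apply: (@le_trans _ _ (K * (s N' - s N))).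
    by rewrite ler_wpM2r ?subr_ge0 ?nds// /K (le_trans (ler_norm _))// lerDl.
  by rewrite ler_pM2l// lerD2r.
move=> P /uniform_nbhs[E [entE EP]].
have [e /= e0 eE] : exists2 e : R, 0 < e & [set xy | ball xy.1 e xy.2] `<=` E.
  by move: entE; rewrite -entourage_ballE.
have near0 : \forall N \near \oo, limn s - s N < e ^+ 2 / K.
  have eK : 0 < e ^+ 2 / K by rewrite divr_gt0// exprn_gt0.
  have h := cs; move/cvgrPdist_lt : h => /(_ _ eK).
  by apply: filterS => N; apply: le_lt_trans; exact: ler_norm.
apply: filterS near0 => N sN; apply: EP => x Dx; apply: eE => /=.
rewrite -ball_normE /=; apply: le_lt_trans (bound N x Dx) _.
rewrite -[ltRHS]gtr0_norm// -sqrtr_sqr ltr_sqrt ?exprn_gt0//.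
by rewrite mulrC -ltr_pdivlMr.
Qed.

End convergence.

(** * Linearity of the Dirichlet problem *)

Section linearity.
Context {R : realType} {n : nat}.
Variables (D : set 'rV[R]_n).
Hypotheses (oD : open D).

Let near_D x : D x -> \forall y \near x, D y.
Proof. by move=> Dx; exact: (open_nbhs_nbhs (conj oD Dx)). Qed.

Lemma is_Ck_eq k (f g : 'rV[R]_n -> R) : (forall x, D x -> f x = g x) ->
  is_Ck k D f -> is_Ck k D g.
Proof.
elim: k f g => [|k IH] f g fg.
  move=> [cf _]; split=> // x Dx; rewrite /prop_for /continuous_at -fg//.
  apply: near_eq_cvg_to (cf x Dx); apply: filterS (near_D Dx) => y Dy.
  by rewrite fg.
move=> [cf Hf]; split=> [x Dx|i].
  rewrite /prop_for /continuous_at -fg//.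
  apply: near_eq_cvg_to (cf x Dx); apply: filterS (near_D Dx) => y Dy.
  by rewrite fg.
have near_fg x : D x -> \forall y \near x, f y = g y.
  by move=> Dx; apply: filterS (near_D Dx) => y Dy; rewrite fg.
have [df Cf] := Hf i; split=> [x Dx|].
  by apply: near_eq_derivable (df x Dx); exact: near_fg.
by apply: IH Cf => x Dx; apply: near_eq_derive; exact: near_fg.
Qed.

Lemma is_Ck_lin k c (f g : 'rV[R]_n -> R) : is_Ck k D f -> is_Ck k D g ->
  is_Ck k D (fun x => c * f x + g x).
Proof.
have cont (f' g' : 'rV[R]_n -> R) x : {for x, continuous f'} -> {for x, continuous g'} ->
    {for x, continuous (fun x => c * f' x + g' x)}.
  move=> cf cg; apply: continuous_add => //; apply: continuous_mul => //.
  exact: continuous_const.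
elim: k f g => [|k IH] f g [cf Hf] [cg Hg].
  by split=> // x Dx; apply: cont; [exact: cf|exact: cg].
split=> [x Dx|i]; first by apply: cont; [exact: cf|exact: cg].
have [df Cf] := Hf i; have [dg Cg] := Hg i.
have dl x : D x -> is_derive x (delta_mx 0 i) (fun x => c * f x + g x)
    (c * partial i f x + partial i g x).
  move=> Dx; have h1 : is_derive x (delta_mx 0 i) f (partial i f x).
    by apply/derivableP; exact: df.
  have h2 : is_derive x (delta_mx 0 i) g (partial i g x).
    by apply/derivableP; exact: dg.
  exact: is_deriveD (is_deriveZ c h1) h2.
split=> [x Dx|]; first by case: (dl x Dx).
apply: is_Ck_eq (IH _ _ Cf Cg) => x Dx.
by rewrite /partial (derive_val (is_derive := dl x Dx)).
Qed.

Variables (a : 'rV[R]_n -> 'M[R]_n) (b : 'rV[R]_n -> 'rV[R]_n).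
Hypotheses (a_C1 : forall i j, is_Ck 1 D (fun x => a x i j)).

(** The clauses are those of [dirichlet_eigenfunction] with a general right-hand side, a form that
    is preserved by linear combinations. *)
Definition dirichlet_solution (u f : 'rV[R]_n -> R) :=
  [/\ is_Ck 2 D u, {within closure D, continuous u},
    forall x, (closure D `\` D) x -> u x = 0 &
    forall x, D x -> elliptic_op a b u x = f x].

Lemma partial_lin c (u v : 'rV[R]_n -> R) i x : is_Ck 1 D u -> is_Ck 1 D v -> D x ->
  partial i (fun y => c * u y + v y) x = c * partial i u x + partial i v x.
Proof.
move=> [_ /(_ i)[du _]] [_ /(_ i)[dv _]] Dx.
have h1 : is_derive x (delta_mx 0 i) u (partial i u x).
  by apply/derivableP; exact: du.
have h2 : is_derive x (delta_mx 0 i) v (partial i v x).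
  by apply/derivableP; exact: dv.
exact: (derive_val (is_derive := is_deriveD (is_deriveZ c h1) h2)).
Qed.

Lemma is_Ck_le k l (f : 'rV[R]_n -> R) : (k <= l)%N -> is_Ck l D f -> is_Ck k D f.
Proof.
elim: k l f => [|k IH] [|l] f //; first by move=> _ [cf _].
by move=> kl [cf Hf]; split=> // i; have [df Cf] := Hf i; split=> //; apply: IH Cf.
Qed.

Lemma elliptic_op_lin c (u v : 'rV[R]_n -> R) x : is_Ck 2 D u -> is_Ck 2 D v -> D x ->
  elliptic_op a b (fun y => c * u y + v y) x =
  c * elliptic_op a b u x + elliptic_op a b v x.
Proof.
move=> Cu Cv Dx; have Cu1 := is_Ck_le (leqnSn 1) Cu; have Cv1 := is_Ck_le (leqnSn 1) Cv.
have dV w i : is_Ck 2 D w -> is_derive x (delta_mx 0 i)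
    (fun y => \sum_j a y i j * partial j w y)
    (partial i (fun y => \sum_j a y i j * partial j w y) x).
  move=> [_ Hw]; apply/derivableP; apply: ex_derive; apply: is_derive_fsum => j.
  apply: is_derive_mul; apply/derivableP.
    by have [_ /(_ i)[+ _]] := a_C1 i j; exact.
  by have [_ [_ /(_ i)[+ _]]] := Hw j; exact.
have alg1 (t e p q : R) : t * (e * p + q) = e * (t * p) + t * q by ring.
have alg2 (t e p q p' q' : R) :
  t * (e * p + q) + (e * p' + q') = e * (t * p + p') + (t * q + q') by ring.
rewrite /elliptic_op; apply: etrans (alg2 _ _ _ _ _ _); congr (_ * _ + _).
  rewrite mulr_sumr -big_split; apply: eq_bigr => i _ /=.
  transitivity (partial i (fun y => c * (\sum_j a y i j * partial j u y) +
      \sum_j a y i j * partial j v y) x).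
    apply: near_eq_derive; apply: filterS (near_D Dx) => y Dy.
    rewrite mulr_sumr -big_split; apply: eq_bigr => j _ /=.
    by rewrite partial_lin// alg1.
  exact: (derive_val (is_derive := is_deriveD (is_deriveZ c (dV u i Cu)) (dV v i Cv))).
rewrite mulr_sumr -big_split; apply: eq_bigr => i _ /=.
by rewrite partial_lin// alg1.
Qed.

Lemma dirichlet_solution_lin c u f v g : dirichlet_solution u f ->
  dirichlet_solution v g ->
  dirichlet_solution (fun x => c * u x + v x) (fun x => c * f x + g x).
Proof.
move=> [Cu cu u0 Lu] [Cv cv v0 Lv]; split.
- exact: is_Ck_lin.
- move=> x; apply: cvgD; last exact: cv.
  by apply: cvgM; [exact: cvg_cst|exact: cu].
- by move=> x bx; rewrite u0// v0// mulr0 addr0.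
- by move=> x Dx; rewrite elliptic_op_lin// Lu// Lv.
Qed.

Lemma partial0 i : partial i (fun=> 0 : R) = (fun=> 0) :> ('rV[R]_n -> R).
Proof. by apply/funext => x; rewrite /partial derive_cst. Qed.

Lemma dirichlet_solution0 : dirichlet_solution (fun=> 0) (fun=> 0).
Proof.
have C0 k : is_Ck k D (fun=> 0 : R).
  elim: k => [|k IH]; first by split=> // x _; exact: continuous_const.
  split=> [x _|i]; first exact: continuous_const.
  by rewrite partial0; split=> // x _; exact: derivable_cst.
split=> //; first by move=> x; exact: cvg_cst.
move=> x _; rewrite /elliptic_op.
under eq_bigr => i _.
  under [X in partial i X]eq_fun => y.
    under eq_bigr do rewrite partial0 mulr0.
    rewrite big1_eq; over.
  rewrite partial0; over.
under [X in _ + X]eq_bigr do rewrite partial0 mulr0.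
by rewrite !big1_eq mulr0 addr0.
Qed.

Lemma dirichlet_solution_sum (N : nat) (c : nat -> R) (u f : nat -> 'rV[R]_n -> R) :
  (forall k, dirichlet_solution (u k) (f k)) ->
  dirichlet_solution (fun x => \sum_(k < N) c k * u k x)
    (fun x => \sum_(k < N) c k * f k x).
Proof.
move=> H; elim: N => [|N IH].
  under eq_fun do rewrite big_ord0; under [X in dirichlet_solution _ X]eq_fun do rewrite big_ord0.
  exact: dirichlet_solution0.
have := dirichlet_solution_lin (c N) (H N) IH.
under eq_fun do rewrite addrC; under [X in dirichlet_solution _ X]eq_fun do rewrite addrC.
under [X in _ -> dirichlet_solution X _]eq_fun do rewrite big_ord_recr.
by under [X in _ -> dirichlet_solution _ X]eq_fun do rewrite big_ord_recr.
Qed.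

End linearity.

(** * Integration against [mu_rev] *)

Section weighted_integral.
Context {R : realType} {d : nat}.
Variables (D : set 'rV[R]_d) (Q : 'rV[R]_d -> R) (r C : R).
Hypotheses (oD : open D) (Dr : forall x, D x -> `|x| <= r).
Hypotheses (cQ : forall x, D x -> {for x, continuous Q})
  (Q_bound : forall x, D x -> `|Q x| <= C).

Let W x := expR (2 * Q x).

Lemma int_revE g : int_rev D Q g = int_rV (ext0 D (fun x => g x * W x)).
Proof.
rewrite /int_rev /eint_rev /int_rV /Rintegral [in LHS]integral_mkcond; congr fine.
apply: eq_integral => x _; rewrite patchE /ext0.
by case: ifPn.
Qed.

Definition bounded_continuous (g : 'rV[R]_d -> R) :=
  (forall x, D x -> {for x, continuous g}) /\
  exists B, forall x, D x -> `|g x| <= B.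

Lemma weight_bounds x : D x -> expR (- (2 * C)) <= W x <= expR (2 * C).
Proof.
move=> /Q_bound; rewrite ler_norml => /andP[h1 h2].
by rewrite !ler_expR; apply/andP; split; lra.
Qed.

Lemma tame_weighted g : bounded_continuous g -> tame (ext0 D (fun x => g x * W x)).
Proof.
move=> [cg [B gB]].
have cW x : D x -> {for x, continuous W}.
  move=> Dx; apply: (@continuous_comp _ _ _ (fun y => 2 * Q y) expR).
    by apply: continuous_mul; [exact: continuous_const|exact: cQ].
  exact: continuous_expR.
have mD := open_measurable_rV oD.
split.
  rewrite (_ : ext0 D _ = (fun x => g x * W x) \_ D); last first.
    by apply/funext => x; rewrite patchE /ext0.
  apply/(measurable_restrictT _ _).1 => //; apply: measurable_fun_rV_continuous => //.
  by move=> x Dx; apply: continuous_mul; [exact: cg|exact: cW].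
exists (`|B| * expR (2 * C)), r => x; split.
  have [Dx|Dx] := pselect (D x); last first.
    by rewrite ext0_notin// normr0 mulr_ge0// expR_ge0.
  rewrite ext0_in// normrM ler_pM//.
    by apply: le_trans (gB x Dx) _; exact: ler_norm.
  by rewrite ger0_norm ?expR_ge0//; case/andP: (weight_bounds Dx).
by move=> rx; apply: ext0_notin => /Dr; rewrite leNgt rx.
Qed.

Lemma bounded_continuousD f g : bounded_continuous f -> bounded_continuous g ->
  bounded_continuous (fun x => f x + g x).
Proof.
move=> [cf [A fA]] [cg [B gB]]; split.
  by move=> x Dx; apply: continuous_add; [exact: cf|exact: cg].
by exists (A + B) => x Dx; apply: le_trans (ler_normD _ _) _; rewrite lerD ?fA ?gB.
Qed.

Lemma bounded_continuousM f g : bounded_continuous f -> bounded_continuous g ->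
  bounded_continuous (fun x => f x * g x).
Proof.
move=> [cf [A fA]] [cg [B gB]]; split.
  by move=> x Dx; apply: continuous_mul; [exact: cf|exact: cg].
by exists (A * B) => x Dx; rewrite normrM ler_pM ?fA ?gB.
Qed.

Lemma bounded_continuous_cst c : bounded_continuous (fun=> c).
Proof. by split=> [x _|]; [exact: continuous_const|exists `|c|]. Qed.

Lemma bounded_continuousZ c f : bounded_continuous f ->
  bounded_continuous (fun x => c * f x).
Proof. exact: bounded_continuousM (bounded_continuous_cst c). Qed.

Lemma bounded_continuous_sum J (s : seq J) (F : J -> 'rV[R]_d -> R) :
  (forall i, bounded_continuous (F i)) ->
  bounded_continuous (fun x => \sum_(i <- s) F i x).
Proof.
move=> bF; elim: s => [|i s IH].
  by under eq_fun do rewrite big_nil; exact: bounded_continuous_cst.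
by under eq_fun do rewrite big_cons; exact: bounded_continuousD.
Qed.

Lemma int_revD f g : bounded_continuous f -> bounded_continuous g ->
  int_rev D Q (fun x => f x + g x) = int_rev D Q f + int_rev D Q g.
Proof.
move=> bf bg; rewrite !int_revE -int_rVD; [|exact: tame_weighted..].
congr int_rV; apply/funext => x; rewrite /ext0; case: ifP; by rewrite ?mulrDl ?addr0.
Qed.

Lemma int_revZ c f : bounded_continuous f ->
  int_rev D Q (fun x => c * f x) = c * int_rev D Q f.
Proof.
move=> bf; rewrite !int_revE -int_rVZ; last exact: tame_weighted.
congr int_rV; apply/funext => x; rewrite /ext0; case: ifP; by rewrite ?mulrA ?mulr0.
Qed.

Lemma int_rev_sum J (s : seq J) (F : J -> 'rV[R]_d -> R) :
  (forall i, bounded_continuous (F i)) ->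
  int_rev D Q (fun x => \sum_(i <- s) F i x) = \sum_(i <- s) int_rev D Q (F i).
Proof.
move=> bF; elim: s => [|i s IH].
  rewrite big_nil; under eq_fun do rewrite big_nil.
  rewrite int_revE (_ : ext0 D _ = (fun=> 0)) ?int_rV0//.
  by apply/funext => x; rewrite /ext0 mul0r if_same.
rewrite big_cons; under eq_fun do rewrite big_cons.
by rewrite int_revD ?IH//; exact: bounded_continuous_sum.
Qed.

Variable (phi : nat -> 'rV[R]_d -> R).
Hypotheses (bphi : forall k, bounded_continuous (phi k))
  (ortho : forall k l, int_rev D Q (fun x => phi k x * phi l x) = (k == l)%:R).

Lemma int_rev_sqr_sum (N : nat) (c : nat -> R) :
  int_rev D Q (fun x => (\sum_(k < N) c k * phi k x) ^+ 2) = \sum_(k < N) c k ^+ 2.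
Proof.
have E x : (\sum_(k < N) c k * phi k x) ^+ 2 =
    \sum_(k < N) \sum_(l < N) c k * c l * (phi k x * phi l x).
  rewrite expr2 big_distrlr /=; apply: eq_bigr => k _; apply: eq_bigr => l _.
  by rewrite mulrACA.
under eq_fun do rewrite E.
have bkl k l c0 : bounded_continuous (fun x => c0 * (phi k x * phi l x)).
  by apply: bounded_continuousZ; exact: bounded_continuousM.
rewrite int_rev_sum; last by move=> k; exact: bounded_continuous_sum.
apply: eq_bigr => k _; rewrite int_rev_sum//.
rewrite (bigD1 k)//= big1 ?addr0 => [|l lk].
  by rewrite int_revZ ?ortho ?eqxx ?mulr1//; exact: bounded_continuousM.
rewrite int_revZ ?ortho; last exact: bounded_continuousM.
by rewrite (_ : (k == l :> nat) = false) ?mulr0//; apply/negbTE; rewrite eq_sym.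
Qed.

(** Expand the nonnegative integral of [(1 - s) ^ 2], where [s] is the partial eigenfunction
    expansion of the constant 1; the integrals of the [phi k] are its coefficients. *)
Lemma bessel (N : nat) : int_rev D Q (fun=> 1) = 1 ->
  \sum_(k < N) int_rev D Q (phi k) ^+ 2 <= 1.
Proof.
move=> J1; pose F k := int_rev D Q (phi k).
pose s x := \sum_(k < N) F k * phi k x.
have bs : bounded_continuous s.
  by apply: bounded_continuous_sum => k; exact: bounded_continuousZ.
have Js : int_rev D Q s = \sum_(k < N) F k ^+ 2.
  rewrite int_rev_sum => [|k]; last exact: bounded_continuousZ.
  by apply: eq_bigr => k _; rewrite int_revZ.
have : 0 <= int_rev D Q (fun x => (1 + (- 2) * s x) + s x ^+ 2).
  rewrite int_revE; apply: int_rV_ge0 => x; rewrite /ext0; case: ifP => // _.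
  rewrite mulr_ge0 ?expR_ge0// (_ : _ + _ = (1 - s x) ^+ 2) ?sqr_ge0//; ring.
have b2 : bounded_continuous (fun x => -2 * s x) by exact: bounded_continuousZ.
have b1 := bounded_continuous_cst 1.
rewrite int_revD; [|exact: bounded_continuousD|exact: (bounded_continuousM bs bs)].
rewrite int_revD// J1 int_revZ// Js int_rev_sqr_sum -/F.
set t := \sum_(k < N) _; lra.
Qed.

End weighted_integral.

(** * The uniform bound on the eigenfunctions and the Fourier series *)

Section eigenbasis.
Context {R : realType} {d : nat}.
Variables (alpha : R) (D : set 'rV[R]_d)
  (a : 'rV[R]_d -> 'M[R]_d) (b : 'rV[R]_d -> 'rV[R]_d) (Q : 'rV[R]_d -> R)
  (lambda : nat -> R) (phi : nat -> 'rV[R]_d -> R).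
Hypotheses (SA : standing_assumptions alpha D a b) (SADJ : self_adjoint D a b Q)
  (EB : dirichlet_eigenbasis D a b Q lambda phi).

Let oD : open D.
Proof. by case: SA => _ _ [oD _ _ _]. Qed.

Let D0 : D !=set0.
Proof. by case: SA => _ _ [_ _ D0 _]. Qed.

Let bD : bounded_set D.
Proof. by case: SA => _ _ [_ _ _ bD]. Qed.

Let d0 : (0 < d)%N.
Proof. by case: SA. Qed.

Let ca i j : continuous (fun x => a x i j).
Proof. by case: SA => _ _ _ [_ _ /(_ i j)[[ca _] _] _] _ x; exact: ca. Qed.

Let cb i : continuous (fun x => b x 0 i).
Proof. by case: SA => _ _ _ [_ _ _ /(_ i)[[cb _] _]] _ x; exact: cb. Qed.

Let a_pos x (v : 'rV[R]_d) : v != 0 -> 0 < (v *m a x *m v^T) 0 0.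
Proof. by case: SA => _ _ _ [_ + _ _] _; exact. Qed.

Let a_C1 i j : is_Ck 1 D (fun x => a x i j).
Proof.
case: SA => _ _ _ [_ _ /(_ i j)[Ca _] _] _.
have {Ca} Ca := is_Ck_le (leqnSn 1) Ca.
case: Ca => ca1 Ha; split=> [x _|l]; first exact: ca1.
have [da [cda _]] := Ha l; split=> [x _|]; first exact: da.
by split=> // x _; exact: cda.
Qed.

Let Q_C1 : is_Ck 1 D Q. Proof. by case: SADJ. Qed.

Let bQ x i : D x -> b x 0 i = \sum_j a x i j * partial j Q x.
Proof. by case: SADJ => _ + _; exact. Qed.

Let cQ x : D x -> {for x, continuous Q}.
Proof. by case: Q_C1 => + _; exact. Qed.

Let Q_bounded : exists C, forall x, D x -> `|Q x| <= C.
Proof.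
have [K K0 HK] := gradient_bounded bD d0 a_pos ca D0 cb bQ.
apply: (loc_lipschitz_bounded oD bD (standing_assumptions_lipschitz SA)) HK K0.
by move=> x i Dx; case: Q_C1 => _ /(_ i)[+ _]; exact.
Qed.

Let phi_sol k : dirichlet_solution D a b (phi k) (fun x => lambda k * phi k x).
Proof. by case: EB => _ /(_ k)[]. Qed.

Let phi_bounded_continuous k : bounded_continuous D (phi k).
Proof.
have [[cphi _] cl _ _] := phi_sol k; split; first exact: cphi.
have D0c : closure D !=set0 by case: D0 => x Dx; exists x; exact: subset_closure.
have cn : {within closure D, continuous (fun x => `|phi k x|)}.
  by move=> x; apply: cvg_norm; exact: cl.
have [c _ hc] := compact_EVT_max D0c (compact_closure_rV bD) cn.
by exists `|phi k c| => x Dx; apply: hc; rewrite inE; exact: subset_closure.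
Qed.

Let ortho k l : int_rev D Q (fun x => phi k x * phi l x) = (k == l)%:R.
Proof. by case: EB => _ _ [_ + _] _; exact. Qed.

Lemma eigenfunction_sum_bounded : (d <= 3)%N ->
  exists C, forall N x, D x -> \sum_(k < N) (phi k x / lambda k) ^+ 2 <= C.
Proof.
move=> d3.
have [eps eps0 ell] := uniform_ellipticity bD d0 a_pos ca D0.
have [C QC] := Q_bounded.
have [r Dcr] := closure_norm_le bD.
have Dr x : D x -> `|x| <= r by move=> Dx; apply: Dcr; exact: subset_closure.
pose m := expR (- (2 * C)); pose M := expR (2 * C).
have m0 : 0 < m by exact: expR_gt0.
have asym x : D x -> (a x)^T = a x by case: SA => _ _ _ [+ _ _ _] _; exact.
(* Chosen so that [1 <= h] and four times the volume of [D] is at most [h], hence at most [h ^ d] as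
   [d] is positive. *)
pose h := 1 + 4 * int_rV (\1_D : 'rV[R]_d -> R).
have I1 : 0 <= int_rV (\1_D : 'rV[R]_d -> R) by apply: int_rV_ge0 => x; rewrite indicE ler0n.
have h1 : 1 <= h by rewrite lerDl mulr_ge0.
have Dh : 4 * int_rV (\1_D : 'rV[R]_d -> R) <= h ^+ d.
  apply: (@le_trans _ _ h); first by rewrite lerDr.
  exact: ler_eXnr.
pose Cst := 4 * 16 ^+ 3 * 8 ^+ 4 * (4 * (8 * d%:R / (eps * m)) ^+ 2 * M * h ^+ 4) : R.
exists Cst => N x Dx.
pose c k := phi k x / lambda k ^+ 2.
pose u y := \sum_(k < N) c k * phi k y.
pose f y := \sum_(k < N) (phi k x / lambda k) * phi k y.
set S := \sum_(k < N) _.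
have S0 : 0 <= S by apply: sumr_ge0 => k _; exact: sqr_ge0.
have uf : dirichlet_solution D a b u f.
  have := dirichlet_solution_sum oD a_C1 N c phi_sol.
  congr (dirichlet_solution _ _ _ _ _); apply/funext => y; apply: eq_bigr => k _.
  (* If [lambda k = 0], both coefficients are 0 since [x / 0 = 0]. *)
  rewrite /c mulrA; congr (_ * _); have [->|l0] := eqVneq (lambda k) 0.
    by rewrite mulr0 invr0 mulr0.
  by field.
have ux : u x = S.
  apply: eq_bigr => k _; rewrite /c exprMn exprVn; ring.
have F2 : int_rV (ext0 D (fun y => f y ^+ 2 * expR (2 * Q y))) = S.
  rewrite -(int_revE D Q (fun y => f y ^+ 2)).
  exact: (int_rev_sqr_sum oD Dr cQ QC phi_bounded_continuous ortho N (fun k => phi k x / lambda k)).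
have [Cu cu u0 Lu] := uf.
have bf : bounded_continuous D f.
  by apply: bounded_continuous_sum => k; exact: bounded_continuousZ.
have tf : tame (ext0 D (fun y => f y ^+ 2 * expR (2 * Q y))).
  exact: (tame_weighted oD Dr cQ QC (bounded_continuousM bf bf)).
have D0c : closure D !=set0 by exists x; exact: subset_closure.
(* The maximum [U = u z] is at least [u x = S], so the resolvent bound [U ^ 2 <= Cst * S] yields
   [S <= Cst]. *)
have [z zD hz] := compact_EVT_max D0c (compact_closure_rV bD) cu.
have Sz : S <= u z by rewrite -ux; apply: hz; rewrite inE; exact: subset_closure.
(* The iteration requires a positive maximum, which [0 < S] ensures; if [S = 0], the claim is that
   [Cst] is nonnegative. *)
move: S0; rewrite le_eqVlt => /predU1P[<-|S0].
  have h0 : 0 <= h := le_trans ler01 h1.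
  apply: mulr_ge0; first by do 2 (apply: mulr_ge0; rewrite ?exprn_ge0//).
  apply: mulr_ge0; last exact: exprn_ge0.
  apply: mulr_ge0; last exact: expR_ge0.
  by apply: mulr_ge0 => //; exact: sqr_ge0.
have Uz : 0 < u z by exact: lt_le_trans Sz.
have Dz : D z.
  apply: contrapT => nDz; move: Uz; rewrite u0 ?ltxx//; split=> //.
  by move: zD; rewrite inE.
have QB y : D y -> m <= expR (2 * Q y) <= M by exact: (weight_bounds QC).
have umax y : D y -> u y <= u z.
  by move=> Dy; apply: hz; rewrite inE; exact: subset_closure.
have := max_sqr_le oD Dr eps0 m0 asym ell a_C1 Q_C1 bQ QB Cu cu u0 Lu tf Uz umax.
move=> /(_ h).
rewrite d0 d3 F2 => /(_ isT h1 Dh (ex_intro _ z (conj Dz erefl))) H.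
have {}H : u z ^+ 2 <= Cst * S.
  by apply: le_trans H _; rewrite /Cst -(mulrA (4 * 16 ^+ 3 * 8 ^+ 4)).
have : S ^+ 2 <= Cst * S.
  by apply: le_trans H; rewrite lerXn2r// nnegrE ltW.
by rewrite expr2 ler_pM2r.
Qed.

Lemma fourier_series_converges : (d <= 3)%N ->
  converges_uniformly_absolutely D (fourier_term D Q lambda phi).
Proof.
move=> d3; have [C HC] := eigenfunction_sum_bounded d3.
have [CQ QC] := Q_bounded.
have [r Dcr] := closure_norm_le bD.
have Dr x : D x -> `|x| <= r by move=> Dx; apply: Dcr; exact: subset_closure.
have J1 : int_rev D Q (fun=> 1) = 1.
  by case: SADJ => _ _; rewrite /int_rev => ->.
have := @square_summable_cvg _ _ D (fun k => int_rev D Q (phi k))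
  (fun k x => phi k x / lambda k) 1 C
  (fun N => bessel oD Dr cQ QC phi_bounded_continuous ortho N J1) HC.
congr (converges_uniformly_absolutely _ _); apply/funext => k; apply/funext => x.
by rewrite /fourier_term mulrA mulrAC.
Qed.

End eigenbasis.

Theorem theorem3 (R : realType) (d : nat) (alpha : R) (D : set 'rV[R]_d)
    (a : 'rV[R]_d -> 'M[R]_d) (b : 'rV[R]_d -> 'rV[R]_d) (Q : 'rV[R]_d -> R)
    (lambda : nat -> R) (phi : nat -> 'rV[R]_d -> R) :
  standing_assumptions alpha D a b ->
  self_adjoint D a b Q ->
  dirichlet_eigenbasis D a b Q lambda phi ->
  let A := converges_uniformly_absolutely D (fourier_term D Q lambda phi) in
  [/\ d = 1%N -> A,
      d = 2%N ->
        (exists c : R, forall x, D x ->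
           Q x = 2^-1 * ln (Num.sqrt (\det (invmx (a x)))) + c) -> A &
      (d <= 3)%N ->
        (exists M : R, forall n x, D x -> `|phi n x| <= M) -> A].
Proof.
move=> SA SADJ EB A; have main := fourier_series_converges SA SADJ EB.
by split=> [d1|d2 _|d3 _]; apply: main => //; rewrite ?d1 ?d2.
Qed.
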